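(* Let $x\in(0,1)$ and let $H$ be a graph with at least one edge and chromatic number $\chi(H)=r$ (so $r\ge2$). Let $\eta>0$, $\sigma:=\sigma(H)$, $h:=|H|$ and $\omega:=(h-\sigma)/(r-1)$. Then there exists $n_0=n_0(\eta,x,H)\in\mathbb{N}$ such that the following holds: if $G$ is a graph on $n\ge n_0$ vertices with degree sequence $d_1\le d_2\le\dots\le d_n$ such that \[d_i\ge\left(g_H(x)-\frac{x\sigma}{h}\right)n+\frac{(r-1)x\sigma}{h-x\sigma}\,i\quad\text{for all } 1\le i\le \left(\frac{h-x\sigma}{(r-1)h}\right)n,\] then $G$ contains an $H$-tiling covering at least $(x-\eta)n$ vertices.
   Context: For a graph $H$, $\sigma(H)$ denotes the smallest possible size of a colour class over all proper colourings of $H$ with $\chi(H)$ colours. The critical chromatic number is $\chi_{cr}(H):=(\chi(H)-1)\frac{|H|}{|H|-\sigma(H)}$, and for $x\in(0,1)$, $g_H(x):=x\left(1-\frac{1}{\chi_{cr}(H)}\right)+(1-x)\left(1-\frac{1}{r-1}\right)$ where $r=\chi(H)$. An $H$-tiling in $G$ is a collection of vertex-disjoint copies of $H$ in $G$. The degree sequence $d_1\le\dots\le d_n$ of $G$ is the list of vertex degrees in non-decreasing order. *)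

(* Defs.v *)
From HB Require Import structures.
From mathcomp Require Import all_boot all_order all_algebra.
From mathcomp Require Import reals.

Set Implicit Arguments.
Unset Strict Implicit.
Unset Printing Implicit Defensive.

Import Order.TTheory GRing.Theory Num.Theory.

Record sgraph := SGraph {
  vertex :> finType;
  edge : rel vertex;
  edge_sym : symmetric edge;
  edge_irrefl : irreflexive edge
}.

Definition degree (G : sgraph) (v : G) : nat := #|[set w | edge v w]|.

Definition degree_sequence (G : sgraph) : seq nat :=
  sort leq [seq degree v | v : G].

(* d_1 <= ... <= d_n is indexed from 1, sequences from 0; only meaningful for
   1 <= i <= #|G|. *)
Definition dseq (G : sgraph) (i : nat) : nat :=
  nth 0 (degree_sequence G) i.-1.

Definition proper_colouring (H : sgraph) (k : nat) (c : {ffun H -> 'I_k}) : bool :=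
  [forall u, forall v, edge u v ==> (c u != c v)].

Definition colourable (H : sgraph) (k : nat) : bool :=
  [exists c : {ffun H -> 'I_k}, proper_colouring c].

Lemma colourable_card (H : sgraph) : colourable H #|H|.
Proof.
apply/existsP; exists [ffun v => enum_rank v].
apply/forallP=> u; apply/forallP=> v; apply/implyP=> uv; rewrite !ffunE.
apply: contraTneq uv => /enum_rank_inj ->; by rewrite edge_irrefl.
Qed.

Definition chi (H : sgraph) : nat :=
  ex_minn (ex_intro (fun k => colourable H k) _ (colourable_card H)).

Definition colour_class (H : sgraph) (k : nat) (c : {ffun H -> 'I_k}) (i : 'I_k) :
  {set H} := [set v | c v == i].

(* The default #|H| of the minimum is harmless: no class is larger, and for a
   nonempty H there is at least one proper colouring and one class. *)
Definition sigma (H : sgraph) : nat :=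
  \big[minn/#|H|]_(c : {ffun H -> 'I_(chi H)} | proper_colouring c)
    \big[minn/#|H|]_(i < chi H) #|colour_class c i|.

(* A copy of H in G (a subgraph isomorphic to H, not necessarily induced) is
   given by an injective homomorphism from H to G. *)
Definition is_copy (H G : sgraph) (f : {ffun H -> G}) : bool :=
  injectiveb f && [forall u, forall v, edge u v ==> edge (f u) (f v)].

Definition copy_vertices (H G : sgraph) (f : {ffun H -> G}) : {set G} :=
  [set f u | u in H].

Definition is_tiling (H G : sgraph) (T : {set {ffun H -> G}}) : Prop :=
  (forall f, f \in T -> is_copy f) /\
  (forall f g, f \in T -> g \in T -> f != g ->
     [disjoint copy_vertices f & copy_vertices g]).

Definition covered (H G : sgraph) (T : {set {ffun H -> G}}) : {set G} :=
  \bigcup_(f in T) copy_vertices f.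

Local Open Scope ring_scope.

Definition chi_cr (R : realType) (H : sgraph) : R :=
  ((chi H)%:R - 1) * (#|H|%:R / (#|H|%:R - (sigma H)%:R)).

Definition gH (R : realType) (H : sgraph) (x : R) : R :=
  x * (1 - 1 / chi_cr R H) + (1 - x) * (1 - 1 / ((chi H)%:R - 1)).

(* Main.v *)
(** Put [al = x sigma / h] and [be = (1 - al) / (r - 1)].  The hypothesis says that
    the vertex of rank [rho n] in the degree order has at most
    [(be + al (1 - rho / be)^+) n] non-neighbours.  No regularity lemma is used.

    A bottle is a complete r-partite graph with one part of size [a] and [r - 1] parts
    of size [b], where [a : b] is close to [al : be].  Shifting the large colour classes
    of H cyclically tiles a proportion of almost [x] of a bottle with copies of H, so it
    suffices to tile almost all of G with bottles.  Adding [eps n] universal vertices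
    first (and discarding the few copies of H that meet them) gives some slack in the
    degree condition.

    Bottles are removed greedily.  For each neighbourhood and each initial segment of
    the degree order, track the deficit of the set in the current remainder, and give a
    vertex the sum of the exponentials of the deficits of the tracked sets containing
    it.  If each removed bottle weighs at most the average (plus an error), all deficits
    stay small, hence the remainder inherits the degree condition until it has at most
    [eta n] vertices.

    A bottle of at most average weight exists: random samples inherit the degree
    condition, so it is enough to find one cheap weighted r-clique in each sample (this
    makes cheap r-cliques dense, and dense r-uniform hypergraphs contain complete
    r-partite ones).  A cheap clique exists for every weight as soon as there is a
    perfect fractional tiling with r-cliques in which one vertex counts [al] and the
    others [be].

    Such a tiling is obtained as the optimum of a linear program that favours vertices
    of low degree.  If [v] is not fully covered and [Q] is in the support, then [v] misses
    a [be]-vertex of [Q], and if this is the only vertex of [Q] it misses then it can be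
    swapped with [v], so its degree rank is at most that of [v].  Counting the
    non-neighbours of suitable maximal cliques of uncovered vertices contradicts the
    degree condition. *)
Require Import Defs.
From HB Require Import structures.
From mathcomp Require Import all_boot all_order all_algebra all_fingroup.
From mathcomp Require Import reals.
From mathcomp Require boolp classical_sets topology normedtype derive.
From mathcomp Require sequences exp.
From mathcomp Require Import ring lra.

Set Implicit Arguments.
Unset Strict Implicit.
Unset Printing Implicit Defensive.

Import Order.TTheory GRing.Theory Num.Theory.

(** * Colourings of H and bottles *)

Definition part_size (s a b : nat) (i : 'I_s.+1) : nat := if i == ord0 then a else b.

(** [s] counts the large parts only, and [ord0] indexes the small one. Edges inside a part are
    allowed. The parts are disjoint as soon as [e] is irreflexive. *)
Definition is_bottle (X : finType) (e : rel X) (s a b : nat) (B : {set X}) : Prop :=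
  exists T : 'I_s.+1 -> {set X},
    [/\ forall i, #|T i| = part_size a b i,
        forall i j u v, i != j -> u \in T i -> v \in T j -> e u v
      & B = \bigcup_i T i].

Section Colourings.

Variable H : sgraph.

Lemma proper_colouringP k (c : {ffun H -> 'I_k}) :
  reflect (forall u v, edge u v -> c u != c v) (proper_colouring c).
Proof.
apply: (iffP forallP) => [cP u v uv|cP u].
  by have /forallP/(_ v)/implyP := cP u; apply.
by apply/forallP => v; apply/implyP; exact: cP.
Qed.

Lemma chi_colourable : colourable H (chi H).
Proof. by rewrite /chi; case: ex_minnP. Qed.

Lemma chi_min k : colourable H k -> chi H <= k.
Proof. by rewrite /chi; case: ex_minnP => ? _; apply. Qed.

Lemma chi_gt1 : (exists u v : H, edge u v) -> 1 < chi H.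
Proof.
move=> [u [v uv]]; have /existsP[c /proper_colouringP/(_ u v uv)] := chi_colourable.
by move: c; case: (chi H) => [|[|k]] c //; [case: (c u)|rewrite !ord1].
Qed.

Lemma sigma_le (c : {ffun H -> 'I_(chi H)}) i :
  proper_colouring c -> sigma H <= #|colour_class c i|.
Proof.
move=> pc; rewrite /sigma -minEnat -leEnat.
apply: le_trans (bigmin_le_cond _ _ pc) _.
exact: (bigmin_le_cond _ _ (isT : xpredT i)).
Qed.

Lemma sigma_attained : 0 < chi H -> exists c : {ffun H -> 'I_(chi H)}, exists i,
  proper_colouring c /\ #|colour_class c i| = sigma H.
Proof.
move=> chi0; have /existsP[c0 pc0] := chi_colourable.
pose i0 : 'I_(chi H) := Ordinal chi0.
have le1 (c : {ffun H -> 'I_(chi H)}) i : (#|colour_class c i| <= #|H|)%O by exact: max_card.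
rewrite /sigma -minEnat.
have [c pc ->] := @eq_bigmin _ nat _ #|H| c0 _
   (fun c => \big[Order.min/#|H|]_(i < chi H) #|colour_class c i|) pc0
   (fun c _ => bigmin_le_id _ _ _ _).
have [i _ ->] := @eq_bigmin _ nat _ #|H| i0 xpredT
   (fun i => #|colour_class c i|) isT (fun i _ => le1 c i).
by exists c, i.
Qed.

(** An empty class of a colouring with [chi H] colours could be dropped with [unlift], against the
    minimality of [chi H]. *)
Lemma sigma_gt0 : (exists u v : H, edge u v) -> 0 < sigma H.
Proof.
move=> edgeH; have chi1 := chi_gt1 edgeH.
have [c [i [/proper_colouringP pc ci]]] := sigma_attained (ltnW chi1).
rewrite lt0n; apply/eqP => s0; move: ci; rewrite s0 => /eqP; rewrite cards_eq0 => /eqP ci.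
have cNi v : c v != i.
  by apply/negP => cv; have := in_set0 v; rewrite -ci inE cv.
move: c i ci cNi pc; have := @chi_min (chi H).-1.
move: chi1; case: (chi H) => [|[|k]] //= _ min c i _ cNi pc.
have : colourable H k.+1.
  apply/existsP; exists [ffun v => odflt ord0 (unlift i (c v))].
  apply/proper_colouringP => u v /pc; rewrite !ffunE.
  case: unliftP (cNi u) => [a ->|->] /=; last by rewrite eqxx.
  case: unliftP (cNi v) => [b ->|->] /=; last by rewrite eqxx.
  by rewrite (inj_eq lift_inj).
by move=> /min; rewrite ltnn.
Qed.

(** Every class of one optimal colouring has at least [sigma H] vertices. This inequality is the
    source of [al < be] in the final proof. *)
Lemma sigma_chi_le : (exists u v : H, edge u v) -> chi H * sigma H <= #|H|.
Proof.
move=> edgeH; have /existsP[c pc] := chi_colourable.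
have -> : #|H| = \sum_(i < chi H) #|colour_class c i|.
  rewrite -sum1_card (partition_big c xpredT) //=; apply: eq_bigr => i _.
  by rewrite -sum1_card; apply: eq_bigl => v; rewrite inE.
rewrite -[X in X * _]card_ord -sum_nat_const.
by apply: leq_sum => i _; exact: sigma_le.
Qed.

Lemma small_class_colouring s : chi H = s.+1 ->
  exists c : {ffun H -> 'I_s.+1},
    (forall u v, edge u v -> c u != c v) /\ #|[set v | c v == ord0]| = sigma H.
Proof.
move=> chiE; have chi0 : 0 < chi H by rewrite chiE.
have [c [i [/proper_colouringP pc ci]]] := sigma_attained chi0.
move: c i pc ci; rewrite /colour_class; move: (sigma H) => sg; rewrite chiE => c i pc ci.
exists [ffun v => tperm ord0 i (c v)]; split=> [u v /pc|].
  by rewrite !ffunE (inj_eq perm_inj).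
rewrite -ci; apply: eq_card => v; rewrite !inE ffunE.
by rewrite -[X in _ == X](tpermR ord0 i) (inj_eq perm_inj).
Qed.

End Colourings.

(** Each fibre of [p] is matched with an initial piece of the enumeration of its part. *)
Lemma inj_into_parts (D J X : finType) (p : D -> J) (T : J -> {set X}) :
  (forall j, #|[set d | p d == j]| <= #|T j|) ->
  (forall i j, i != j -> [disjoint T i & T j]) ->
  exists f : D -> X, injective f /\ forall d, f d \in T (p d).
Proof.
move=> fib dis; pose F j := [set d | p d == j].
have [d0|D0] := pickP (fun d : D => true); last first.
  have noD (d : D) : False by have := D0 d.
  by exists (fun d => False_rect X (noD d)); split => d; case: (noD d).
move=> _; have /card_gt0P[x0 _] : 0 < #|T (p d0)|.
  by apply: leq_trans (fib _); apply/card_gt0P; exists d0; rewrite inE.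
have ind d : index d (enum (F (p d))) < #|T (p d)|.
  by apply: leq_trans (fib _); rewrite cardE index_mem mem_enum inE.
pose f d := nth x0 (enum (T (p d))) (index d (enum (F (p d)))).
have fT d : f d \in T (p d) by rewrite -mem_enum mem_nth // -cardE.
exists f; split=> // d d' fE.
have pE : p d = p d'.
  apply/eqP; apply: contraT => /dis; rewrite disjoint_subset => /subsetP /(_ _ (fT d)).
  by rewrite inE fE fT.
move: fE; rewrite /f pE => /eqP; rewrite nth_uniq ?enum_uniq -?cardE //; last by rewrite -pE.
move=> /eqP iE; rewrite -(@nth_index _ d d (enum (F (p d')))) ?mem_enum ?inE ?pE //.
by rewrite iE nth_index // mem_enum inE.
Qed.

(** Capacity count: the smallest classes of all copies fill the small part exactly, and each large
    part receives every large class [K] times, which takes [K * (#|H| - sigma H)] places. *)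
Lemma bottle_H_tiling (H G : sgraph) (s K b : nat) (B : {set G}) :
  chi H = s.+2 -> (exists u v : H, edge u v) ->
  K * (#|H| - sigma H) <= b ->
  is_bottle (@edge G) s.+1 (s.+1 * K * sigma H) b B ->
  exists T : {set {ffun H -> G}},
    [/\ is_tiling T, #|T| = s.+1 * K & forall f, f \in T -> copy_vertices f \subset B].
Proof.
move=> chiE edgeH Kb [P [cP eP BE]].
have [c [pc c0]] := small_class_colouring chiE.
(* Copy [(t, l)] puts the colour class [lift ord0 j] into the part
   [lift ord0 (j + t)], so every large part receives each large class [K] times. *)
pose D := ('I_s.+1 * 'I_K * H)%type.
pose p (d : D) : 'I_s.+2 :=
  if unlift ord0 (c d.2) is Some j then lift ord0 (j + d.1.1)%R else ord0.
have dis i j : i != j -> [disjoint P i & P j].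
  move=> ij; rewrite disjoint_subset; apply/subsetP => u ui; rewrite inE.
  by apply/negP => uj; have := eP _ _ _ _ ij ui uj; rewrite edge_irrefl.
have fib j : #|[set d : D | p d == j]| <= #|P j|.
  rewrite cP /part_size; case: eqP => [->|/eqP j0].
    have -> : [set d : D | p d == ord0] = setX setT [set v | c v == ord0].
      apply/setP => -[t v]; rewrite !inE /p /=.
      by case: unliftP => [i ->|->]; rewrite ?eqxx ?(negPf (neq_lift _ _)) // eq_sym (negPf (neq_lift _ _)).
    by rewrite cardsX cardsT card_prod !card_ord c0.
  apply: leq_trans Kb.
  have [i Ej|] := unliftP ord0 j; last by move=> E; rewrite E eqxx in j0.
  (* Over a fixed large part the colour of a vertex determines the shift, so [g] recovers the whole
     triple from the copy number and the vertex. *)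
  pose g (d : 'I_K * H) : D := ((odflt ord0 (omap (fun i' => i - i')%R (unlift ord0 (c d.2)))), d.1, d.2).
  have sub : [set d : D | p d == j] \subset g @: setX setT [set v | c v != ord0].
    apply/subsetP => -[[t l] v]; rewrite inE /p /= => /eqP pE.
    apply/imsetP; exists (l, v).
      by rewrite !inE /=; apply/negP => /eqP cv; move: pE j0; rewrite cv unlift_none => <-; rewrite eqxx.
    rewrite /g /=; move: pE; case: unliftP => [i' _|_]; last by move=> E; rewrite -E eqxx in j0.
    by rewrite Ej => /lift_inj <-; rewrite /= addrC addKr.
  apply: leq_trans (subset_leq_card sub) (leq_trans (leq_imset_card _ _) _).
  rewrite cardsX cardsT card_ord leq_mul2l; apply/orP; right.
  rewrite -c0 -(cardsC [set v | c v == ord0]) addKn.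
  by apply/subset_leq_card/subsetP => v; rewrite !inE.
have [f [f_inj fP]] := inj_into_parts fib dis.
pose cp (t : 'I_s.+1 * 'I_K) : {ffun H -> G} := [ffun v => f (t, v)].
have [u0 _] := edgeH.
have cp_inj : injective cp.
  by move=> t t' /ffunP /(_ u0); rewrite !ffunE => /f_inj [].
have sub t : copy_vertices (cp t) \subset B.
  apply/subsetP => _ /imsetP[v _ ->]; rewrite ffunE BE; apply/bigcupP.
  by exists (p (t, v)).
exists (cp @: setT); split; last by move=> _ /imsetP[t _ ->].
- split.
    move=> _ /imsetP[t _ ->]; apply/andP; split.
      by apply/injectiveP => u v; rewrite !ffunE => /f_inj [].
    apply/forallP => u; apply/forallP => v; apply/implyP => /pc uv; rewrite !ffunE.
    apply: eP (fP _) (fP _); apply: contra uv; rewrite /p /=.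
    case: unliftP => [i ->|->]; case: unliftP => [j ->|->] //.
    by rewrite (inj_eq lift_inj) => /eqP /addIr ->.
  move=> _ _ /imsetP[t _ ->] /imsetP[t' _ ->] tt'.
  rewrite disjoint_subset; apply/subsetP => _ /imsetP[u _ ->]; rewrite inE.
  apply/negP => /imsetP[v _]; rewrite !ffunE => /f_inj [E _].
  by move: tt'; rewrite E eqxx.
- by rewrite card_imset // cardsT card_prod !card_ord.
Qed.

(** * Universal vertices and unions of tilings *)

Section UniversalVertices.

Variables (G : sgraph) (k : nat).

Definition universal_edge (u v : G + 'I_k) : bool :=
  match u, v with inl u, inl v => edge u v | inr i, inr j => i != j | _, _ => true end.

Lemma universal_edge_sym : symmetric universal_edge.
Proof. by move=> [u|i] [v|j] //=; [exact: edge_sym|rewrite eq_sym]. Qed.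

Lemma universal_edge_irrefl : irreflexive universal_edge.
Proof. by move=> [u|i] /=; [exact: edge_irrefl|rewrite eqxx]. Qed.

Definition add_universal : sgraph := SGraph universal_edge_sym universal_edge_irrefl.

End UniversalVertices.

Lemma card_disjoint_bigcup (I T : finType) (D : {set I}) (F : I -> {set T}) :
  {in D &, forall i j, i != j -> [disjoint F i & F j]} ->
  #|\bigcup_(i in D) F i| = \sum_(i in D) #|F i|.
Proof.
move=> dF; rewrite big_mkcond /= [RHS]big_mkcond /= -sum1_card.
rewrite partition_disjoint_bigcup => [|i j ij].
  by apply: eq_bigr => i _; rewrite sum1_card; case: ifP; rewrite ?cards0.
case: ifP => iD; last by rewrite -setI_eq0 set0I.
by case: ifP => jD; [exact: dF|rewrite -setI_eq0 setI0].
Qed.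

Lemma copy_vertex (H G : sgraph) (f : {ffun H -> G}) v : f v \in copy_vertices f.
Proof. exact: imset_f. Qed.

Lemma card_copy_vertices (H G : sgraph) (f : {ffun H -> G}) :
  is_copy f -> #|copy_vertices f| = #|H|.
Proof.
by move=> /andP[/injectiveP f_inj _]; rewrite /copy_vertices card_imset.
Qed.

Lemma card_covered (H G : sgraph) (T : {set {ffun H -> G}}) :
  is_tiling T -> #|covered T| = #|T| * #|H|.
Proof.
move=> [cT dT]; rewrite /covered card_disjoint_bigcup // -sum_nat_const.
by apply: eq_bigr => f /cT; exact: card_copy_vertices.
Qed.

(** Choosing a universal vertex in each copy that meets one is injective, because the copies are
    disjoint; so at most [k.+1] copies are lost. *)
Lemma restrict_tiling (H G : sgraph) (k : nat)
    (TT : {set {ffun H -> add_universal G k.+1}}) : 0 < #|H| ->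
  is_tiling TT ->
  exists2 T : {set {ffun H -> G}}, is_tiling T & #|TT| <= #|T| + k.+1.
Proof.
move=> /card_gt0P[u0 _] [cT dT].
pose emb (f : {ffun H -> G}) : {ffun H -> add_universal G k.+1} := [ffun v => inl (f v)].
pose T := [set f | emb f \in TT].
pose bad := [set f in TT | [exists j, inr j \in copy_vertices f]].
exists T.
  split.
    move=> f; rewrite inE => /cT /andP[/injectiveP f_inj /forallP ef].
    apply/andP; split.
      apply/injectiveP => u v uv; apply: f_inj; rewrite !ffunE uv //.
    apply/forallP => u; apply/forallP => v; apply/implyP => uv.
    by have /forallP/(_ v)/implyP/(_ uv) := ef u; rewrite !ffunE.
  move=> f g; rewrite !inE => fT gT fg.
  have : emb f != emb g.
    apply: contra fg => /eqP/ffunP E; apply/eqP/ffunP => v.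
    by have := E v; rewrite !ffunE => -[].
  move=> /(dT _ _ fT gT); rewrite !disjoint_subset => /subsetP D.
  apply/subsetP => _ /imsetP[u _ ->]; rewrite inE; apply/negP => /imsetP[v _ E].
  have := D _ (copy_vertex (emb f) u); rewrite inE => /negP; apply.
  by rewrite ffunE E -(ffunE (fun v => inl (g v))) copy_vertex.
have sub : TT \subset (emb @: T) :|: bad.
  apply/subsetP => f fT; rewrite inE [f \in bad]inE fT /=.
  have [_|] := boolP [exists j, inr j \in copy_vertices f]; first by rewrite orbT.
  rewrite negb_exists => /forallP H0; rewrite orbF.
  have fin v : exists x, f v = inl x.
    by move: (copy_vertex f v); case: (f v) => [x|j] h; [exists x|have := H0 j; rewrite h].
  have [f' f'P] := fin_all_exists fin.
  have fE : f = emb (finfun f') by apply/ffunP => v; rewrite !ffunE f'P.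
  by rewrite fE imset_f // inE -fE.
apply: leq_trans (subset_leq_card sub) _; rewrite cardsU.
apply: leq_trans (leq_subr _ _) _; apply: leq_add; first exact: leq_imset_card.
have pickj f : exists j : 'I_k.+1, f \in bad -> inr j \in copy_vertices f.
  have [/setIdP[_ /existsP[j fj]]|fb] := boolP (f \in bad); first by exists j.
  by exists ord0.
have [j jP] := fin_all_exists pickj.
rewrite -[X in _ <= X]card_ord -(@card_in_imset _ _ j); first exact: max_card.
move=> f g fb gb E; apply/eqP; apply: contraT => fg.
have badT h : h \in bad -> h \in TT by rewrite inE => /andP[].
have := dT f g (badT f fb) (badT g gb) fg; rewrite disjoint_subset => /subsetP /(_ _ (jP f fb)).
by rewrite inE E jP.
Qed.

Lemma union_tiling (H G : sgraph) (q : nat) (F : {set {set G}}) :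
  0 < #|H| -> trivIset F ->
  (forall B, B \in F -> exists T : {set {ffun H -> G}},
     [/\ is_tiling T, #|T| = q & forall f, f \in T -> copy_vertices f \subset B]) ->
  exists2 T : {set {ffun H -> G}}, is_tiling T & #|T| = #|F| * q.
Proof.
move=> /card_gt0P[u0 _] tF FT.
have /fin_all_exists[T TP] B : exists T : {set {ffun H -> G}}, B \in F ->
   [/\ is_tiling T, #|T| = q & forall f, f \in T -> copy_vertices f \subset B].
  by have [/FT[T TP]|_] := boolP (B \in F); [exists T|exists set0].
have disF B B' f g : B \in F -> B' \in F -> B != B' -> f \in T B -> g \in T B' ->
    [disjoint copy_vertices f & copy_vertices g].
  move=> BF B'F BB' fB gB'; have [_ _ /(_ f fB) fs] := TP B BF.
  have [_ _ /(_ g gB') gs] := TP B' B'F.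
  apply: disjointWl fs (disjointWr gs _).
  by move/trivIsetP: tF; apply.
(* As [H] is nonempty, a copy is not disjoint from itself. Hence no copy occurs for two different
   [B], and the sizes of the families add up. *)
have ndis f : ~~ [disjoint copy_vertices f & @copy_vertices H G f].
  rewrite -setI_eq0 setIid; apply/set0Pn; exists (f u0); exact: copy_vertex.
exists (\bigcup_(B in F) T B).
  split=> [f /bigcupP[B BF fB]|f g /bigcupP[B BF fB] /bigcupP[B' B'F gB'] fg].
    by have [[cT _] _ _] := TP B BF; exact: cT.
  have [E|BB'] := eqVneq B B'; last exact: disF BF B'F BB' fB gB'.
  by rewrite -E in gB'; have [[_ dT] _ _] := TP B BF; exact: dT.
rewrite card_disjoint_bigcup.
  by rewrite -sum_nat_const; apply: eq_bigr => B /TP[].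
move=> B B' BF B'F BB'; rewrite disjoint_subset; apply/subsetP => f fB.
by rewrite inE; apply/negP => fB'; have := ndis f; rewrite (disF _ _ _ _ BF B'F BB' fB fB').
Qed.

(** [pos] is the index in a list of the vertices sorted by degree. It breaks ties, so distinct
    vertices have distinct ranks, counted from 0. *)
Lemma degree_position (G : sgraph) : exists pos : G -> nat,
  [/\ injective pos, forall v, pos v < #|G|, forall v, dseq G (pos v).+1 = degree v
    & forall i j, i <= j -> j < #|G| -> dseq G i.+1 <= dseq G j.+1].
Proof.
pose vs := sort (relpre (@degree G) leq) (enum G).
have vsP : perm_eq vs (enum G) by rewrite perm_sort.
have szvs : size vs = #|G| by rewrite size_sort -cardE.
have mem v : v \in vs by rewrite (perm_mem vsP) mem_enum.
have dsE : degree_sequence G = map (@degree G) vs by rewrite /degree_sequence /image_mem sort_map.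
exists (fun v => index v vs); split.
- by move=> u v E; rewrite -(nth_index u (mem u)) E nth_index.
- by move=> v; rewrite -szvs index_mem.
- by move=> v; rewrite /dseq dsE (nth_map v) ?index_mem // nth_index.
- move=> i j ij jn; rewrite /dseq /=.
  have sz : size (degree_sequence G) = #|G| by rewrite dsE size_map.
  apply: (sorted_leq_nth leq_trans leqnn); rewrite ?inE ?sz //.
    by apply: sort_sorted; exact: leq_total.
  exact: leq_ltn_trans jn.
Qed.

Local Open Scope ring_scope.

(** * Perfect fractional tilings by weighted cliques *)

Section LinearProgram.
Import boolp classical_sets topology normedtype derive.
Import numFieldNormedType.Exports.
Local Open Scope classical_set_scope.

(** The feasible set is closed, lies in the box of side [C], and contains 0 because [b] is
    nonnegative; a linear form attains its maximum on it. *)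
Lemma compact_polyhedron_max (R : realType) (n : nat) (J : finType)
    (a : J -> 'I_n -> R) (b : J -> R) (c : 'I_n -> R) (C : R) :
  (forall j, 0 <= b j) ->
  (forall w : 'rV[R]_n, (forall i, 0 <= w ord0 i) ->
     (forall j, \sum_i a j i * w ord0 i <= b j) -> forall i, w ord0 i <= C) ->
  exists w : 'rV[R]_n,
    [/\ forall i, 0 <= w ord0 i, forall j, \sum_i a j i * w ord0 i <= b j
     & forall w' : 'rV[R]_n, (forall i, 0 <= w' ord0 i) ->
        (forall j, \sum_i a j i * w' ord0 i <= b j) ->
        \sum_i c i * w' ord0 i <= \sum_i c i * w ord0 i].
Proof.
move=> b0 wC.
pose lin (d : 'I_n -> R) := fun w : 'rV[R]_n => \sum_i d i * w ord0 i.
have lin_cont d : continuous (lin d).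
  pose F i := fun w : 'rV[R]_n => d i * w ord0 i.
  have Fc i : xpredT i -> continuous (F i).
    move=> _ w.
    by apply: continuousM; [exact: cst_continuous|exact: coord_continuous].
  have H := continuous_big (x0 := 0) (@add_continuous R^o) Fc. by move=> w; exact: (H (index_enum _) w).
pose A : set 'rV[R]_n := [set w : 'rV[R]_n | forall i, 0 <= w ord0 i] `&`
   [set w : 'rV[R]_n | forall j, lin (a j) w <= b j].
have Acl : closed A.
  apply: closedI.
    rewrite (_ : [set _ | _] = \bigcap_(i in setT) ((fun w : 'rV[R]_n => w ord0 i) @^-1` [set x | 0 <= x])); last first.
      by apply/seteqP; split => [w wP i _|w wP i]; [exact: wP|exact: (wP i Logic.I)].
    apply: closed_bigI => i _.
    have /continuous_closedP cl := @coord_continuous R 1 n ord0 i.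
    by have := cl _ (@closed_ge R 0); apply.
  rewrite (_ : [set _ | _] = \bigcap_(j in setT) (lin (a j) @^-1` [set x | x <= b j])); last first.
    by apply/seteqP; split => [w wP j _|w wP j]; [exact: wP|exact: (wP j Logic.I)].
  apply: closed_bigI => j _.
  have /continuous_closedP cl := lin_cont (a j).
  by have := cl _ (@closed_le R (b j)); apply.
have Aco : compact A.
  apply: (subclosed_compact Acl (@rV_compact R n (fun=> `[0, C]%classic)
    (fun=> @segment_compact _ 0 C))) => w [w0 wb] i /=.
  by rewrite in_itv /= w0 wC.
have A0 : A !=set0.
  exists 0; split => /= [i|j]; first by rewrite mxE.
  by rewrite /lin big1 // => i _; rewrite mxE mulr0.
have [|w wA wmax] := @compact_EVT_max _ R (lin c) A A0 Aco.
  exact/continuous_subspaceT.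
move: wA; rewrite inE => -[w0 wb]; exists w; split => // w' w'0 w'b.
by apply: wmax; rewrite inE.
Qed.

End LinearProgram.

Lemma lp_max (R : realType) (I J : finType)
    (a : J -> I -> R) (b : J -> R) (c : I -> R) (C : R) :
  (forall j, 0 <= b j) ->
  (forall w : I -> R, (forall i, 0 <= w i) ->
     (forall j, \sum_i a j i * w i <= b j) -> forall i, w i <= C) ->
  exists w : I -> R,
    [/\ forall i, 0 <= w i, forall j, \sum_i a j i * w i <= b j
     & forall w' : I -> R, (forall i, 0 <= w' i) ->
        (forall j, \sum_i a j i * w' i <= b j) ->
        \sum_i c i * w' i <= \sum_i c i * w i].
Proof.
move=> b0 wC.
have reind (d : I -> R) (w : 'rV[R]_#|I|) :
    \sum_i d (enum_val i) * w ord0 i = \sum_i d i * w ord0 (enum_rank i).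
  rewrite [RHS](reindex (@enum_val I I)) /=; last first.
    by exists enum_rank => i _; rewrite ?enum_valK ?enum_rankK.
  by apply: eq_bigr => i _; rewrite enum_valK.
have [||w [w0 wb wmax]] := @compact_polyhedron_max R #|I| J
  (fun j i => a j (enum_val i)) b (fun i => c (enum_val i)) C => //.
  move=> w w0 wb i; rewrite -[i]enum_valK.
  by apply: (wC (fun i => w ord0 (enum_rank i))) => // j; rewrite -reind.
exists (fun i => w ord0 (enum_rank i)); split => // [j|w' w'0 w'b].
  by rewrite -reind.
have sumE (d : I -> R) : \sum_i d i * w' i =
    \sum_i d i * (\row_i w' (enum_val i)) ord0 (enum_rank i).
  by apply: eq_bigr => i _; rewrite mxE enum_rankK.
rewrite -reind sumE -reind; apply: wmax => [i|j]; first by rewrite mxE.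
by rewrite reind -sumE.
Qed.

Section CliqueTiling.

Variables (R : realType) (X : finType) (e : rel X) (s : nat) (al be : R).
Hypotheses (e_sym : symmetric e) (e_irr : irreflexive e).
Hypotheses (s_gt0 : (0 < s)%N) (al_gt0 : 0 < al) (al_lt_be : al < be).
Hypothesis al_be : al + s%:R * be = 1.

Local Notation role := 'I_s.+1.
Local Notation tuples := {ffun role -> X}.

Definition role_weight (i : role) : R := if i == ord0 then al else be.

Definition is_clique (q : tuples) : bool :=
  [forall i, forall j, (i != j) ==> e (q i) (q j)].

Definition mass (q : tuples) (v : X) : R :=
  \sum_i role_weight i * (q i == v)%:R.

Definition cover_by (w : tuples -> R) (v : X) : R := \sum_q w q * mass q v.

Lemma is_cliqueP (q : tuples) :
  reflect (forall i j, i != j -> e (q i) (q j)) (is_clique q).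
Proof.
apply: (iffP forallP) => [H i j ij|H i].
  by move/forallP: (H i) => /(_ j); rewrite ij.
by apply/forallP => j; apply/implyP; exact: H.
Qed.

Lemma be_gt0 : 0 < be. Proof. exact: lt_trans al_lt_be. Qed.

Lemma role_weight_gt0 i : 0 < role_weight i.
Proof. by rewrite /role_weight; case: ifP => // _; exact: be_gt0. Qed.

Lemma mass_ge0 q v : 0 <= mass q v.
Proof.
by apply: sumr_ge0 => i _; rewrite mulr_ge0 ?ler0n // ltW // role_weight_gt0.
Qed.

Lemma card_nonzero_roles : #|[pred j : role | j != ord0]| = s.
Proof. by have := cardC1 (ord0 : role); rewrite card_ord. Qed.

Lemma sum_roles (g : role -> R) :
  \sum_i role_weight i * g i = al * g ord0 + be * \sum_(j | j != ord0) g j.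
Proof.
rewrite (bigD1 ord0) //= {1}/role_weight eqxx mulr_sumr; congr (_ + _).
by apply: eq_bigr => i /negPf ni; rewrite /role_weight ni.
Qed.

Lemma sum_role_weight : \sum_i role_weight i = 1.
Proof.
rewrite (eq_bigr (fun i => role_weight i * 1)) => [|i _]; last by rewrite mulr1.
by rewrite sum_roles sumr_const card_nonzero_roles mulr1 [be * _]mulrC al_be.
Qed.

Lemma sum_mass (g : X -> R) q :
  \sum_v g v * mass q v = \sum_i role_weight i * g (q i).
Proof.
under eq_bigr do rewrite mulr_sumr.
rewrite exchange_big /=; apply: eq_bigr => i _.
rewrite (bigD1 (q i)) //= eqxx mulr1 big1 ?addr0 1?mulrC // => v.
by rewrite eq_sym => /negPf ->; rewrite !mulr0.
Qed.

Lemma sum_cover (g : X -> R) w :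
  \sum_v g v * cover_by w v = \sum_q w q * \sum_i role_weight i * g (q i).
Proof.
under eq_bigr do rewrite mulr_sumr.
rewrite exchange_big /=; apply: eq_bigr => q _.
by rewrite -sum_mass mulr_sumr; apply: eq_bigr => v _; rewrite mulrCA.
Qed.

Lemma cover_indicator q0 v : cover_by (fun q => (q == q0)%:R) v = mass q0 v.
Proof.
rewrite /cover_by (bigD1 q0) //= eqxx mul1r big1 ?addr0 // => q.
by move=> /negPf ->; rewrite mul0r.
Qed.

Lemma coverD w1 w2 v :
  cover_by (fun q => w1 q + w2 q) v = cover_by w1 v + cover_by w2 v.
Proof. by rewrite /cover_by -big_split /=; apply: eq_bigr => q _; rewrite mulrDl. Qed.

Lemma coverZ a w v : cover_by (fun q => a * w q) v = a * cover_by w v.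
Proof. by rewrite /cover_by mulr_sumr; apply: eq_bigr => q _; rewrite mulrA. Qed.

Lemma cover_sum (J : finType) (P : pred J) (w : J -> tuples -> R) v :
  cover_by (fun q => \sum_(j | P j) w j q) v = \sum_(j | P j) cover_by (w j) v.
Proof.
rewrite /cover_by exchange_big /=; apply: eq_bigr => q _.
by rewrite mulr_suml.
Qed.

Lemma small_step (I : finType) (a b : I -> R) :
  (forall i, 0 <= a i) -> (forall i, a i = 0 -> 0 <= b i) ->
  exists2 t, 0 < t & forall i t', 0 <= t' <= t -> 0 <= a i + t' * b i.
Proof.
(* Since division by 0 gives 0, the indices with [a i = 0] add nothing to [S]; for the others
   [(1 + S)^-1] is a short enough step. *)
move=> a0 b0; set S := \sum_i `|b i| / a i.
have S0 : 0 <= S by apply: sumr_ge0 => i _; rewrite divr_ge0.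
have t0 : 0 < (1 + S)^-1 by rewrite invr_gt0 ltr_wpDr.
exists (1 + S)^-1 => // i t' /andP[t'0 t't].
have [ai0|ai0] := eqVneq (a i) 0.
  by rewrite ai0 add0r mulr_ge0 // b0.
have ai : 0 < a i by rewrite lt_neqAle eq_sym ai0 a0.
have bS : `|b i| / a i <= S.
  by rewrite /S (bigD1 i) //= lerDl sumr_ge0 // => j _; rewrite divr_ge0.
have : t' * `|b i| <= a i.
  have h1 : `|b i| <= S * a i by rewrite -ler_pdivrMr.
  have h2 : t' * (1 + S) <= 1 by rewrite -ler_pdivlMr ?ltr_wpDr // div1r.
  apply: le_trans (ler_wpM2l t'0 h1) _.
  rewrite mulrA -[leRHS]mul1r ler_wpM2r ?a0 //; apply: le_trans h2.
  by rewrite mulrDr mulr1 lerDr.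
have := ler_norm (- b i); rewrite normrN => h.
have := ler_wpM2l t'0 h; lra.
Qed.

(** Optimality is stated to first order: a direction [d] along which one can move a little without
    violating a constraint does not increase the objective. All later arguments only exhibit such
    directions. *)
Lemma clique_tiling_optimum (c : X -> R) :
  exists w : tuples -> R,
    [/\ forall q, 0 <= w q, forall q, ~~ is_clique q -> w q = 0,
        forall v, cover_by w v <= 1
      & forall d : tuples -> R,
          (forall q, d q < 0 -> 0 < w q) -> (forall q, ~~ is_clique q -> d q = 0) ->
          (forall v, 0 < cover_by d v -> cover_by w v < 1) ->
          \sum_v c v * cover_by d v <= 0].
Proof.
(* The rows [inl v] say that [v] is covered at most once; the rows [inr q] force weight 0 on tuples
   that are not cliques. *)
pose a (j : X + tuples) (q : tuples) : R := match j with
  inl v => mass q v | inr q' => (~~ is_clique q' && (q == q'))%:R end.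
pose b (j : X + tuples) : R := match j with inl _ => 1 | inr _ => 0 end.
pose c' q := \sum_v c v * mass q v.
have aE w v : \sum_q a (inl v) q * w q = cover_by w v.
  by apply: eq_bigr => q _; rewrite mulrC.
have aE' w q : \sum_q' a (inr q) q' * w q' = (~~ is_clique q)%:R * w q.
  rewrite (bigD1 q) //= eqxx andbT big1 ?addr0 // => q' /negPf ->.
  by rewrite andbF mul0r.
have cE w : \sum_q c' q * w q = \sum_v c v * cover_by w v.
  by rewrite sum_cover; apply: eq_bigr => q _; rewrite /c' sum_mass mulrC.
have [||w [w0 wb wmax]] := @lp_max R tuples (X + tuples)%type a b c' al^-1.
- by case.
(* The bound [al^-1] holds because [q] puts mass at least [al] on [q ord0], which is covered at most
   once. *)
- move=> w w0 wb q; have := wb (inl (q ord0)); rewrite aE /= => h.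
  rewrite -(ler_pM2r al_gt0) mulVf ?gt_eqF //; apply: le_trans h.
  rewrite /cover_by (bigD1 q) //= -[leLHS]addr0 lerD //; last first.
    by apply: sumr_ge0 => q' _; rewrite mulr_ge0 ?mass_ge0.
  rewrite ler_wpM2l // /mass (bigD1 ord0) //= eqxx mulr1 {1}/role_weight eqxx.
  rewrite lerDl sumr_ge0 // => i _.
  by rewrite mulr_ge0 // ltW // role_weight_gt0.
have wz q : ~~ is_clique q -> w q = 0.
  move=> nq; have := wb (inr q); rewrite aE' nq mul1r /= => h.
  by apply/eqP; rewrite eq_le h w0.
exists w; split => // [v|d dneg dclq dcov]; first by have := wb (inl v); rewrite aE.
have [|t1 t1p H1] := @small_step _ w d w0.
  by move=> q wq; rewrite leNgt; apply/negP => /dneg; rewrite wq ltxx.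
have [||t2 t2p H2] := @small_step _ (fun v => 1 - cover_by w v)
   (fun v => - cover_by d v).
- by move=> v; have := wb (inl v); rewrite aE /=; lra.
- move=> v wv; rewrite leNgt oppr_lt0; apply/negP => /dcov; lra.
- pose t := Num.min t1 t2.
  have tp : 0 < t by rewrite lt_min t1p.
  have H1' q : 0 <= w q + t * d q by apply: H1; rewrite (ltW tp) /t ge_min lexx.
  have H2' v : 0 <= 1 - cover_by w v + t * - cover_by d v.
    by apply: H2; rewrite (ltW tp) /t ge_min lexx orbT.
  have := wmax (fun q => w q + t * d q) H1'.
  rewrite !cE => H.
  have {}H : \sum_v c v * cover_by (fun q => w q + t * d q) v
     <= \sum_v c v * cover_by w v.
    apply: H => -[v|q]; rewrite ?aE ?aE' /=.
      rewrite coverD coverZ; have := H2' v; lra.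
    by case: (boolP (is_clique q)) => [|nq]; rewrite ?mul0r // wz // dclq // !(mulr0, addr0).
  have E : \sum_v c v * cover_by (fun q => w q + t * d q) v =
     \sum_v c v * cover_by w v + t * \sum_v c v * cover_by d v.
    rewrite mulr_sumr -big_split /=; apply: eq_bigr => v _.
    by rewrite coverD coverZ; ring.
  by move: H; rewrite E gerDl pmulr_rle0.
Qed.

Lemma mass_tperm (q : tuples) (j : role) u : j != ord0 ->
  mass [ffun i => q (tperm ord0 j i)] u =
  mass q u + (be - al) * ((q ord0 == u)%:R - (q j == u)%:R).
Proof.
move=> j0; have j0' : ord0 != j by rewrite eq_sym.
rewrite /mass (reindex_inj (@perm_inj _ (tperm ord0 j))) /=.
rewrite (bigD1 ord0) //= (bigD1 j) //= [in RHS](bigD1 ord0) //= [in RHS](bigD1 j) //=.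
rewrite !ffunE !tpermK tpermL tpermR.
rewrite (eq_bigr (fun i => role_weight i * (q i == u)%:R)); last first.
  move=> i /andP[i0 ij]; rewrite ffunE tpermK tpermD 1?eq_sym //.
set S := \sum_(i | _) _; rewrite /role_weight (negPf j0) eqxx; ring.
Qed.

Lemma mass_roles (q : tuples) u :
  mass q u = al * (q ord0 == u)%:R + be * \sum_(j | j != ord0) (q j == u)%:R.
Proof. exact: sum_roles. Qed.

(** On average over the role that becomes light, the vertex in role [ord0] rises to [be], and each
    other vertex gives up [(be - al) / s]. *)
Lemma sum_mass_tperm (q : tuples) u :
  \sum_(j | j != ord0) s%:R^-1 * mass [ffun i => q (tperm ord0 j i)] u =
  be * (q ord0 == u)%:R
  + (be - (be - al) / s%:R) * \sum_(j | j != ord0) (q j == u)%:R.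
Proof.
rewrite (eq_bigr (fun j => s%:R^-1 * (mass q u + (be - al) * (q ord0 == u)%:R)
   - s%:R^-1 * (be - al) * (q j == u)%:R)); last first.
  by move=> j j0; rewrite mass_tperm //; ring.
rewrite sumrB sumr_const card_nonzero_roles -mulr_sumr mass_roles.
have s0 : s%:R != 0 :> R by rewrite pnatr_eq0 -lt0n.
rewrite -mulr_natr; field; exact: s0.
Qed.

Lemma is_clique_tperm (q : tuples) j : is_clique q -> is_clique [ffun i => q (tperm ord0 j i)].
Proof.
move=> /is_cliqueP cq; apply/is_cliqueP => i k ik; rewrite !ffunE; apply: cq.
by rewrite (inj_eq perm_inj).
Qed.

Definition replace (q : tuples) (i : role) (v : X) : tuples :=
  [ffun k => if k == i then v else q k].

Lemma is_clique_replace q i v : is_clique q ->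
  (forall k, k != i -> e v (q k)) -> is_clique (replace q i v).
Proof.
move=> /is_cliqueP cq ev; apply/is_cliqueP => j k jk; rewrite !ffunE.
case: eqP => [ji|/eqP ji]; case: eqP => [ki|/eqP ki].
- by move: jk; rewrite ji ki eqxx.
- exact: ev.
- by rewrite e_sym; apply: ev.
- exact: cq.
Qed.

(** * Structure of an optimal fractional tiling *)

Section Optimum.

Variables (rho : X -> R) (ga xi : R).
Hypothesis rho_le1 : forall v, rho v <= 1.

Variable w : tuples -> R.
Hypothesis w_ge0 : forall q, 0 <= w q.
Hypothesis w_clique : forall q, ~~ is_clique q -> w q = 0.
Hypothesis w_cover : forall v, cover_by w v <= 1.
Hypothesis w_opt : forall d : tuples -> R,
  (forall q, d q < 0 -> 0 < w q) -> (forall q, ~~ is_clique q -> d q = 0) ->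
  (forall v, 0 < cover_by d v -> cover_by w v < 1) ->
  \sum_v (2 - rho v) * cover_by d v <= 0.

(** The objective coefficients are positive, so extra covering always pays, and they decrease in
    [rho], so vertices of low degree are preferred. *)
Let gain_gt0 v : 0 < 2 - rho v.
Proof. by have := rho_le1 v; lra. Qed.

Lemma support_clique q : 0 < w q -> is_clique q.
Proof. by apply: contraTT => /w_clique ->; rewrite ltxx. Qed.

(** Otherwise the weight of [q] itself could be raised. *)
Lemma uncovered_clique q : is_clique q -> exists i, cover_by w (q i) = 1.
Proof.
move=> cq; suff /existsP[i /eqP ?] : [exists i, cover_by w (q i) == 1] by exists i.
apply: contraT; rewrite negb_exists => /forallP H.
have := @w_opt (fun q' => (q' == q)%:R).
rewrite leNgt => /(_ _ _ _) /negP [].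
- by move=> q'; rewrite ltNge ler0n.
- by move=> q' nq'; case: eqP => // q'q; rewrite q'q cq in nq'.
- move=> v; rewrite cover_indicator => mv; rewrite lt_neqAle w_cover andbT.
  apply/negP => /eqP cv; move: mv; rewrite /mass big1 ?ltxx // => i _.
  by case: eqP => [qi|_]; rewrite ?mulr0 //; have := H i; rewrite qi cv eqxx.
- under eq_bigr do rewrite cover_indicator.
  rewrite sum_mass (bigD1 ord0) //= ltr_wpDr ?mulr_gt0 ?role_weight_gt0 //.
  by apply: sumr_ge0 => i _; rewrite mulr_ge0 // ltW // role_weight_gt0.
Qed.

(** Moving weight from [q] to the clique with [v] in place of [q i] changes the objective at rate
    [be * (rho (q i) - rho v)], which cannot be positive. *)
Lemma swap_main q v i : 0 < w q -> cover_by w v < 1 -> i != ord0 ->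
  (forall k, k != i -> e v (q k)) -> rho (q i) <= rho v.
Proof.
move=> wq cv i0 ev.
have cq := support_clique wq.
have cq1 := is_clique_replace cq ev; set q1 := replace q i v in cq1.
have massE u : mass q1 u - mass q u = be * ((v == u)%:R - (q i == u)%:R).
  rewrite /mass (bigD1 i) //= [X in _ - X](bigD1 i) //= ffunE eqxx.
  rewrite (eq_bigr (fun k => role_weight k * (q k == u)%:R)); last first.
    by move=> k /negPf ki; rewrite ffunE ki.
  by rewrite /role_weight (negPf i0); ring.
have covE u : cover_by (fun q' => (q' == q1)%:R + -1 * (q' == q)%:R) u =
    be * ((v == u)%:R - (q i == u)%:R).
  by rewrite coverD coverZ !cover_indicator -massE; ring.
have := @w_opt (fun q' => (q' == q1)%:R + -1 * (q' == q)%:R).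
have -> : \sum_u (2 - rho u) * cover_by (fun q' => (q' == q1)%:R + -1 * (q' == q)%:R) u
   = be * (rho (q i) - rho v).
  under eq_bigr do rewrite covE.
  rewrite (eq_bigr (fun u => be * (2 - rho u) * (v == u)%:R - be * (2 - rho u) * (q i == u)%:R)); last by move=> u _; ring.
  rewrite sumrB.
  have S x : \sum_u be * (2 - rho u) * (x == u)%:R = be * (2 - rho x).
    rewrite (bigD1 x) //= eqxx mulr1 big1 ?addr0 // => u.
    by rewrite eq_sym => /negPf ->; rewrite mulr0.
  by rewrite !S; ring.
rewrite pmulr_rle0 ?be_gt0 // subr_le0; apply.
- by move=> q'; case: eqP => [_|_]; case: eqP => [->|_] //; rewrite !(mulr0, addr0, ltxx, ltr10).
- move=> q' nq'.
  have ne q2 : is_clique q2 -> (q' == q2) = false.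
    by move=> cq2; apply/negP => /eqP E; rewrite E cq2 in nq'.
  by rewrite !ne // mulr0 addr0.
- move=> u; rewrite covE pmulr_rgt0 ?be_gt0 //; case: eqP => [<- //|_].
  by rewrite sub0r oppr_gt0 ltNge ler0n.
Qed.

Lemma adjacent_main_false q v : 0 < w q -> cover_by w v < 1 ->
  exists2 i, i != ord0 & ~~ e v (q i).
Proof.
move=> wq cv; suff /existsP[i /andP[i0 ei]] :
  [exists i, (i != ord0) && ~~ e v (q i)] by exists i.
apply: contraT; rewrite negb_exists => /forallP H.
have ev k : k != ord0 -> e v (q k) by move=> k0; have := H k; rewrite k0 /= negbK.
have cq := support_clique wq.
set q1 := replace q ord0 v.
have cq1 : is_clique q1 by apply: is_clique_replace.
have q1E j : q1 j = if j == ord0 then v else q j by rewrite /q1 ffunE.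
have s1 : 1 <= s%:R :> R by rewrite ler1n.
have s0 : s%:R != 0 :> R by rewrite gt_eqF // (lt_le_trans ltr01).
(* Let each [q j] in turn take over the light role: suitable multiples of these
   reassignments of [q] and of [q1] together cover every vertex of [q] as [q] did,
   and cover [v] in addition. *)
set bs := be - (be - al) / s%:R.
have bs_le : bs <= be.
  by rewrite /bs gerBl divr_ge0 // subr_ge0 ltW.
have bs_gt0 : 0 < bs.
  have : (be - al) / s%:R <= be - al.
    by rewrite ler_pdivrMr ?(lt_le_trans ltr01) // ler_peMr // subr_ge0 ltW.
  by move: al_gt0; rewrite /bs; lra.
(* The multiple [al / be] of the average for [q] restores the mass [al] of [q ord0]. The multiple
   [t] for [q1] then restores [be] on every heavy vertex, since [(al / be + t) * bs = be]. *)
pose t := be / bs - al / be.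
have t0 : 0 < t.
  have h1 : 1 <= be / bs by rewrite ler_pdivlMr // mul1r.
  have h2 : al / be < 1 by rewrite ltr_pdivrMr ?be_gt0 // mul1r.
  by rewrite /t; lra.
pose tp (q : tuples) j : tuples := [ffun i => q (tperm ord0 j i)].
pose d q' : R := \sum_(j | j != ord0) s%:R^-1 * (al / be * (q' == tp q j)%:R
   + t * (q' == tp q1 j)%:R) + -1 * (q' == q)%:R.
have covE u : cover_by d u = t * be * (v == u)%:R.
  rewrite coverD coverZ cover_sum cover_indicator.
  rewrite (eq_bigr (fun j => al / be * (s%:R^-1 * mass (tp q j) u)
     + t * (s%:R^-1 * mass (tp q1 j) u))); last first.
    by move=> j j0; rewrite coverZ coverD !coverZ !cover_indicator; ring.
  rewrite big_split /= -[X in X + _ + _]mulr_sumr -[X in _ + X + _]mulr_sumr.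
  rewrite !sum_mass_tperm mass_roles q1E eqxx.
  have -> : \sum_(j | j != ord0) (q1 j == u)%:R = \sum_(j | j != ord0) (q j == u)%:R :> R.
    by apply: eq_bigr => j /negPf j0; rewrite q1E j0.
  rewrite -/bs /t; field; rewrite !gt_eqF ?be_gt0 //.
have := @w_opt d; rewrite leNgt => /(_ _ _ _) /negP [].
- move=> q'; rewrite /d; case: eqP => [->//|_]; rewrite mulr0 addr0 ltNge.
  rewrite sumr_ge0 // => j _; rewrite mulr_ge0 ?invr_ge0 // addr_ge0 // mulr_ge0 //.
    by rewrite divr_ge0 // ltW // be_gt0.
  exact: ltW.
- move=> q' nq'.
  have ne q2 : is_clique q2 -> (q' == q2) = false.
    by move=> cq2; apply/negP => /eqP E; rewrite E cq2 in nq'.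
  rewrite /d ne // big1 ?mulr0 ?addr0 // => j _.
  by rewrite !ne ?is_clique_tperm // !mulr0 addr0 mulr0.
- move=> u; rewrite covE; case: eqP => [<- //|_]; by rewrite mulr0 ltxx.
- under eq_bigr do rewrite covE.
  rewrite (bigD1 v) //= eqxx big1 ?addr0 => [|u /negPf vu].
    by rewrite mulr1 !mulr_gt0 ?be_gt0.
  by rewrite eq_sym vu !mulr0.
Qed.

Let uncov u := 1 - cover_by w u.

Let uncov_ge0 u : 0 <= uncov u. Proof. by rewrite subr_ge0. Qed.

(** By [adjacent_main_false], [v] misses a heavy vertex of [q]. If it misses a second vertex, weight
    [al] is gained directly. If not, [swap_main] ranks the missed vertex no higher than [v], and the
    rank term supplies [al / be * be = al]. *)
Lemma missing_weight q v : 0 < w q -> cover_by w v < 1 ->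
  be <= \sum_i role_weight i * (~~ e v (q i))%:R /\
  al + be <= \sum_i role_weight i * (~~ e v (q i))%:R
    + al / be * \sum_i role_weight i * (rho (q i) <= rho v)%R%:R.
Proof.
move=> wq cv; have [i i0 ei] := adjacent_main_false wq cv.
have rw0 k (b : bool) : 0 <= role_weight k * b%:R.
  by rewrite mulr_ge0 // ltW // role_weight_gt0.
have rwi : role_weight i = be by rewrite /role_weight (negPf i0).
have ab0 : 0 <= al / be by rewrite divr_ge0 // ltW // be_gt0.
have lw0 : 0 <= al / be * \sum_i role_weight i * (rho (q i) <= rho v)%R%:R.
  by rewrite mulr_ge0 // sumr_ge0.
rewrite (bigD1 i) //= ei mulr1 rwi; split.
  by rewrite lerDl sumr_ge0.
have [/existsP[k /andP[ki ek]]|H] := boolP [exists k, (k != i) && ~~ e v (q k)].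
  rewrite (bigD1 k) //= ek mulr1.
  have : al <= role_weight k by rewrite /role_weight; case: ifP => // _; exact: ltW.
  have : 0 <= \sum_(j < s.+1 | (j != i) && (j != k)) role_weight j * (~~ e v (q j))%:R.
    by apply: sumr_ge0.
  lra.
have ri : rho (q i) <= rho v.
  apply: (swap_main wq) => // k ki; move: H; rewrite negb_exists => /forallP /(_ k).
  by rewrite ki negbK.
have : al / be * be <= al / be * \sum_j role_weight j * (rho (q j) <= rho v)%R%:R.
  rewrite ler_wpM2l // (bigD1 i) //= ri rwi mulr1 lerDl.
  by rewrite sumr_ge0.
rewrite divfK ?gt_eqF ?be_gt0 //.
have : 0 <= \sum_(j | j != i) role_weight j * (~~ e v (q j))%:R by rewrite sumr_ge0.
lra.
Qed.

Let total := \sum_q w q.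

(** This is [missing_weight] summed against [w], after splitting each vertex count by
    [1 = uncov u + cover_by w u]. *)
Lemma missing_uncovered v : cover_by w v < 1 ->
  \sum_u (~~ e v u)%:R * uncov u + be * total <= \sum_u (~~ e v u)%:R /\
  \sum_u (~~ e v u)%:R * uncov u + (al + be) * total <= \sum_u (~~ e v u)%:R
   + al / be * (\sum_u (rho u <= rho v)%R%:R - \sum_u (rho u <= rho v)%R%:R * uncov u).
Proof.
move=> cv.
have splitE (g : X -> R) :
    \sum_u g u = \sum_u g u * uncov u + \sum_u g u * cover_by w u.
  by rewrite -big_split /=; apply: eq_bigr => u _; rewrite /uncov; ring.
rewrite (splitE (fun u => (~~ e v u)%:R)) (splitE (fun u => (rho u <= rho v)%R%:R)).
rewrite [_ + _ - _]addrAC subrr add0r -addrA !lerD2l !sum_cover /total !mulr_sumr.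
rewrite -big_split /=.
split; apply: ler_sum => q _.
all: have [->|wq] := eqVneq (w q) 0; first by rewrite !(mul0r, mulr0, addr0).
all: have {}wq : 0 < w q by rewrite lt_neqAle eq_sym wq w_ge0.
all: have [m1 m2] := missing_weight wq cv.
- by rewrite mulrC ler_wpM2l // ltW.
- rewrite [leLHS]mulrC (mulrCA (al / be)) -mulrDr ler_wpM2l // ltW //.
Qed.

Definition clique_set (S : {set X}) : bool :=
  [forall u in S, forall v in S, (u != v) ==> e u v].

Lemma clique_setP (S : {set X}) :
  reflect {in S &, forall u v, u != v -> e u v} (clique_set S).
Proof.
apply: (iffP forall_inP) => [H u v uS vS uv|H u uS].
  by move/forall_inP: (H u uS) => /(_ v vS); rewrite uv.
by apply/forall_inP => v vS; apply/implyP; exact: H.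
Qed.

Lemma clique_setU1 (S : {set X}) v : clique_set S -> (forall u, u \in S -> e u v) ->
  clique_set (v |: S).
Proof.
move=> /clique_setP cS ev; apply/clique_setP => x y.
rewrite !inE => /orP[/eqP->|xS] /orP[/eqP->|yS]; rewrite ?eqxx //.
- by move=> _; rewrite e_sym; exact: ev.
- by move=> _; exact: ev.
- exact: cS.
Qed.

(** Any [s.+1] of these vertices would form a clique forbidden by [uncovered_clique]. *)
Lemma card_uncovered_clique_set (S : {set X}) : clique_set S ->
  {in S, forall v, cover_by w v < 1} -> (#|S| <= s)%N.
Proof.
move=> /clique_setP cS SU; rewrite leqNgt; apply/negP => sS.
pose q : tuples := [ffun i => enum_val (widen_ord sS i)].
have qS i : q i \in S by rewrite ffunE; exact: enum_valP.
have [i qi] : exists i, cover_by w (q i) = 1.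
  apply: uncovered_clique; apply/is_cliqueP => i j ij; apply: cS => //.
  apply: contra ij; rewrite !ffunE => /eqP /enum_val_inj /(congr1 val) /= ij.
  by apply/eqP/val_inj.
by have := SU _ (qS i); rewrite qi ltxx.
Qed.

(** Fully covered vertices have [uncov] equal to 0, so only the uncovered ones have to be missed by
    some member of [S]. *)
Lemma double_count (S : {set X}) (g : pred X) :
  (forall u, g u -> cover_by w u < 1 -> exists2 v, v \in S & ~~ e v u) ->
  \sum_u (g u)%:R * uncov u <= \sum_(v in S) \sum_u (~~ e v u)%:R * uncov u.
Proof.
move=> H; rewrite exchange_big /=; apply: ler_sum => u _; rewrite -mulr_suml.
have [gu|_] := boolP (g u); last first.
  by rewrite mul0r mulr_ge0 // sumr_ge0.
have := w_cover u; rewrite le_eqVlt => /orP[/eqP cu|/(H _ gu)[v vS ev]].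
  by rewrite /uncov cu subrr !mulr0.
rewrite ler_wpM2r // (bigD1 v) //= ev lerDl.
by rewrite sumr_ge0.
Qed.

Hypothesis xi_le_ga : 0 <= xi <= ga.
Hypothesis rank_le : forall v,
  \sum_u (rho u <= rho v)%R%:R <= (rho v + xi) * #|X|%:R.
Hypothesis missing_le : forall v,
  \sum_u (~~ e v u)%:R <= (be + al * Num.max 0 (1 - rho v / be) - ga) * #|X|%:R.

Let unc := \sum_u uncov u.

Lemma total_uncovered : unc = #|X|%:R - total.
Proof.
rewrite /unc /uncov sumrB sumr_const; congr (_ - _).
transitivity (\sum_u 1 * cover_by w u); first by apply: eq_bigr => u _; rewrite mul1r.
rewrite sum_cover; apply: eq_bigr => q _.
under eq_bigr do rewrite mulr1.
by rewrite sum_role_weight // mulr1.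
Qed.

Lemma missing_high v : cover_by w v < 1 -> be <= rho v ->
  \sum_u (~~ e v u)%:R * uncov u <= be * unc.
Proof.
move=> cv rv; have [m _] := missing_uncovered cv; have := missing_le v.
have -> : Num.max 0 (1 - rho v / be) = 0.
  by apply/max_idPl; rewrite subr_le0 ler_pdivlMr ?be_gt0 // mul1r.
have /andP[xi0 ga0] := xi_le_ga.
have : 0 <= ga * #|X|%:R by rewrite mulr_ge0 // (le_trans xi0).
rewrite total_uncovered; move: m; lra.
Qed.

(** The terms in [rho v] cancel: the degree condition improves by [al / be * rho v] per vertex of
    [X], while the vertices of rank at most [rho v] contribute the same amount up to [xi], which
    [ga] absorbs. *)
Lemma missing_low v : cover_by w v < 1 -> rho v < be ->
  \sum_u (~~ e v u)%:R * uncov u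
    + al / be * \sum_u (rho u <= rho v)%R%:R * uncov u <= (al + be) * unc.
Proof.
move=> cv rv; have [_ m] := missing_uncovered cv; have := missing_le v.
have -> : Num.max 0 (1 - rho v / be) = 1 - rho v / be.
  by apply/max_idPr; rewrite subr_ge0 ler_pdivrMr ?be_gt0 // mul1r ltW.
have /andP[xi0 ga0] := xi_le_ga.
have ab0 : 0 <= al / be by rewrite divr_ge0 // ltW // be_gt0.
have ab1 : al / be <= 1 by rewrite ler_pdivrMr ?be_gt0 // mul1r ltW.
have r := ler_wpM2l ab0 (rank_le v).
have : al / be * xi * #|X|%:R <= ga * #|X|%:R.
  rewrite ler_wpM2r //; apply: le_trans ga0.
  by rewrite ler_piMl.
have -> : al * (1 - rho v / be) = al - al / be * rho v by ring.
rewrite total_uncovered; move: m r; set x := al / be; set N := _%:R; nra.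
Qed.

Lemma optimum_covers : unc <= 0.
Proof.
pose high (S : {set X}) := clique_set S &&
  (S \subset [set v | (cover_by w v < 1) && (be <= rho v)]).
pose unco (S : {set X}) := clique_set S && (S \subset [set v | cover_by w v < 1]).
have high0 : high set0.
  by rewrite /high sub0set andbT; apply/clique_setP => u v; rewrite inE.
(* [Sh] is a maximal clique of uncovered vertices of rank at least [be], so it misses every such
   vertex. [C] below collects the uncovered vertices of smaller rank that it does not miss. *)
have [Sh /maxsetP[/andP[cSh ShU] Shmax] _] := maxset_exists high0.
have ShP v : v \in Sh -> cover_by w v < 1 /\ be <= rho v.
  by move=> /(subsetP ShU); rewrite inE => /andP[].
have Sh_miss u : cover_by w u < 1 -> be <= rho u -> exists2 v, v \in Sh & ~~ e v u.
  move=> cu ru; suff /exists_inP[v vS ev] : [exists v in Sh, ~~ e v u] by exists v.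
  apply: contraT; rewrite negb_exists => /forallP H.
  have ev v : v \in Sh -> e v u by move=> vS; have := H v; rewrite vS /= negbK.
  have uS : u \in Sh.
    rewrite -(Shmax (u |: Sh)) ?setU11 ?subsetUr //.
    rewrite /high clique_setU1 //= subUset ShU andbT sub1set inE cu ru //.
  by have := ev _ uS; rewrite e_irr.
have k1E : \sum_(v in Sh) \sum_u (~~ e v u)%:R * uncov u <= #|Sh|%:R * (be * unc).
  rewrite mulr_natl -sumr_const; apply: ler_sum => v /ShP[cv rv].
  exact: missing_high.
have unc0 : 0 <= unc by apply: sumr_ge0.
have b0 := be_gt0.
pose C := [set v | [&& cover_by w v < 1, rho v < be & [forall u in Sh, e u v]]].
have low_miss u : cover_by w u < 1 -> rho u < be -> u \notin C ->
    exists2 v, v \in Sh & ~~ e v u.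
  move=> cu ru; rewrite inE cu ru /= negb_forall => /existsP[v].
  by rewrite negb_imply => /andP[vS ev]; exists v.
(* If [C] is empty, [Sh] misses all uncovered vertices, so
   [unc <= s * be * unc = (1 - al) * unc]. *)
have [C0|[v0 v0C]] := set_0Vmem C.
  have kS : (#|Sh| <= s)%N.
    by apply: card_uncovered_clique_set => // v /ShP[].
  rewrite -(ler_nat R) in kS.
  have h : #|Sh|%:R * (be * unc) <= s%:R * (be * unc).
    by rewrite ler_wpM2r // mulr_ge0 // ltW.
  have H : unc <= #|Sh|%:R * (be * unc).
    apply: le_trans k1E.
    have -> : unc = \sum_u (xpredT u)%:R * uncov u.
      by apply: eq_bigr => u _; rewrite mul1r.
    apply: double_count => u _ cu; have [ru|ru] := leP be (rho u); first exact: Sh_miss.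
    by apply: low_miss => //; rewrite C0 inE.
  have : unc * (al + s%:R * be) <= s%:R * be * unc by rewrite al_be; move: H h; lra.
  rewrite mulrDr => h2; rewrite -(pmulr_rle0 _ al_gt0); move: h2; lra.
(* Otherwise take [v'] of largest rank in [C] and extend [v' |: Sh] to a maximal uncovered clique
   [S]. The members of [S :\: Sh] have rank below [be] by the maximality of [Sh]. *)
have [v' v'C v'max] : exists2 v', v' \in C & forall u, u \in C -> rho u <= rho v'.
  by case: (@Order.TotalTheory.arg_maxP _ R X v0 (mem C) rho v0C) => v' ? ?; exists v'.
move: (v'C); rewrite inE => /and3P[cv' rv' /forall_inP ev'].
have uncoSh : unco (v' |: Sh).
  rewrite /unco clique_setU1 //= subUset sub1set inE cv' /=.
  by apply/subsetP => u /ShP[]; rewrite inE.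
have [S /maxsetP[/andP[cS SU] Smax] ShS] := maxset_exists uncoSh.
have SP v : v \in S -> cover_by w v < 1 by move=> /(subsetP SU); rewrite inE.
have S_miss u : cover_by w u < 1 -> exists2 v, v \in S & ~~ e v u.
  move=> cu; suff /exists_inP[v vS ev] : [exists v in S, ~~ e v u] by exists v.
  apply: contraT; rewrite negb_exists => /forallP H.
  have ev v : v \in S -> e v u by move=> vS; have := H v; rewrite vS /= negbK.
  have uS : u \in S.
    rewrite -(Smax (u |: S)) ?setU11 ?subsetUr //.
    by rewrite /unco clique_setU1 //= subUset SU andbT sub1set inE cu.
  by have := ev _ uS; rewrite e_irr.
have ShS' : Sh \subset S by apply: subset_trans ShS; exact: subsetUr.
have v'S : v' \in S :\: Sh.
  rewrite inE (subsetP ShS) ?setU11 // andbT; apply/negP => /ShP[_].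
  by rewrite leNgt rv'.
have SlowP v : v \in S :\: Sh -> rho v < be.
  rewrite inE => /andP[vSh vS]; rewrite ltNge; apply: contra vSh => rv.
  have [u uS eu] := Sh_miss _ (SP _ vS) rv.
  case: (eqVneq u v) => [<- //|uv]; move/clique_setP: cS eu => -> //.
  exact: (subsetP ShS').
(* [Fv] is the uncovered mass of rank at most that of [v']. By the choice of [v'], the rest is
   missed by [Sh] alone, which gives [I1]; all of it is missed by [S], which gives [I2]. The extra
   [Fv] term in [I2] comes from [missing_low] at [v'] only. *)
pose Fv := \sum_u (rho u <= rho v')%R%:R * uncov u.
have I1 : unc - Fv <= #|Sh|%:R * (be * unc).
  apply: le_trans k1E.
  have -> : unc - Fv = \sum_u (~~ (rho u <= rho v')%R)%:R * uncov u.
    rewrite /unc /Fv -sumrB; apply: eq_bigr => u _.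
    by case: (rho u <= rho v') => /=; ring.
  apply: double_count => u nru cu; have [ru|ru] := leP be (rho u); first exact: Sh_miss.
  by apply: low_miss => //; apply: contra nru; exact: v'max.
have I2 : unc + al / be * Fv <=
    #|Sh|%:R * (be * unc) + #|S :\: Sh|%:R * ((al + be) * unc).
  have := @double_count S xpredT (fun u _ => @S_miss u).
  rewrite (eq_bigr uncov) => [|u _]; last by rewrite mul1r.
  rewrite (big_setID Sh) /= (setIidPr ShS') -/unc.
  have : \sum_(v in S :\: Sh) \sum_u (~~ e v u)%:R * uncov u + al / be * Fv <=
     #|S :\: Sh|%:R * ((al + be) * unc).
    rewrite mulr_natl -sumr_const.
    have -> : al / be * Fv = \sum_(v in S :\: Sh) (v == v')%:R * (al / be * Fv).
      rewrite (bigD1 v') //= eqxx mul1r big1 ?addr0 // => v /andP[_ /negPf ->].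
      by rewrite mul0r.
    rewrite -big_split /=; apply: ler_sum => v vS.
    apply: le_trans (missing_low _ (SlowP _ vS)); last first.
      by apply: SP; move: vS; rewrite inE => /andP[].
    rewrite lerD2l; case: eqP => [->|_]; first by rewrite mul1r.
    rewrite mul0r mulr_ge0 ?divr_ge0 //; try exact: ltW.
    by apply: sumr_ge0 => u _; rewrite mulr_ge0.
  move: k1E; lra.
have kS : (#|Sh| + #|S :\: Sh| <= s)%N.
  rewrite (_ : (_ + _)%N = #|S|); last by rewrite -(cardsID Sh S) (setIidPr ShS').
  by apply: card_uncovered_clique_set.
have I3 : al + #|S :\: Sh|%:R * be <= 1 - #|Sh|%:R * be.
  have := ler_wpM2r (ltW b0) (_ : (#|Sh| + #|S :\: Sh|)%:R <= s%:R :> R).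
  rewrite ler_nat natrD => /(_ kS); move: al_be; lra.
set k1 := #|Sh|%:R in I1 I2 I3 *; set k2 := #|_|%:R in I2 I3 *.
have ab0 : 0 < al / be by rewrite divr_gt0.
have J1 : (al + k2 * be) * unc <= Fv.
  have := ler_wpM2r unc0 I3; move: I1; lra.
have J2 := ler_wpM2l (ltW ab0) J1.
have J3 : al / be * ((al + k2 * be) * unc) = al / be * al * unc + k2 * al * unc.
  by field; rewrite gt_eqF.
have J4 := ler_wpM2r unc0 I3.
(* Inserting the lower bound [J1] for [Fv] into [I2] cancels all terms in [k2] and leaves a positive
   multiple of [unc]. *)
have J5 : (al + al / be * al) * unc <= 0.
  move: I2 J2 J4; rewrite J3; lra.
have p : 0 < al + al / be * al by apply: addr_gt0 => //; exact: mulr_gt0.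
by rewrite -(pmulr_rle0 _ p).
Qed.

End Optimum.

(** By [optimum_covers] the optimal [w] has total weight at least [#|X|], yet it covers each vertex
    at most once. So the [w]-average of the cost of a clique is at most the average of [y]. *)
Lemma cheap_clique (rho : X -> R) (ga xi : R) (y : X -> R) :
  (0 < #|X|)%N -> (forall v, rho v <= 1) -> 0 <= xi <= ga ->
  (forall v, \sum_u (rho u <= rho v)%R%:R <= (rho v + xi) * #|X|%:R) ->
  (forall v, \sum_u (~~ e v u)%:R <=
     (be + al * Num.max 0 (1 - rho v / be) - ga) * #|X|%:R) ->
  (forall v, 0 <= y v) ->
  exists2 q : tuples, is_clique q &
    #|X|%:R * \sum_i role_weight i * y (q i) <= \sum_v y v.
Proof.
move=> X0 rho1 xiga rank miss y0.
have [w [w0 wcl wcov wopt]] := clique_tiling_optimum (fun v => 2 - rho v).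
have unc0 := optimum_covers rho1 w0 wcl wcov wopt xiga rank miss.
have tot := total_uncovered w.
set N : R := #|X|%:R in tot *.
have N0 : 0 < N by rewrite ltr0n.
have totN : N <= \sum_q w q by move: unc0; rewrite tot; lra.
suff /existsP[q /andP[cq qy]] : [exists q : tuples, is_clique q &&
   (N * \sum_i role_weight i * y (q i) <= \sum_v y v)] by exists q.
apply: contraT; rewrite negb_exists => /forallP H.
pose cost q := \sum_i role_weight i * y (q i).
have Hq q : w q != 0 -> \sum_v y v < N * cost q.
  move=> wq; have cq : is_clique q by apply: contraNT wq => /wcl ->.
  by have := H q; rewrite cq /= -ltNge.
have h1 : \sum_q w q * cost q <= \sum_v y v.
  rewrite -(sum_cover y w); apply: ler_sum => v _.
  by rewrite ler_piMr.
have h2 : \sum_q w q * (N * cost q) <= N * \sum_v y v.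
  under eq_bigr do rewrite mulrCA.
  by rewrite -mulr_sumr ler_wpM2l // ltW.
have [q0 wq0] : exists q, w q != 0.
  apply/existsP; apply: contraT; rewrite negb_exists => /forallP Hw.
  move: totN; rewrite big1 => [|q _]; first by rewrite leNgt N0.
  by apply/eqP; rewrite -[_ == _]negbK Hw.
have h3 : (\sum_q w q) * \sum_v y v < \sum_q w q * (N * cost q).
  rewrite mulr_suml (bigD1 q0) //= [ltRHS](bigD1 q0) //= ltr_leD //.
    by rewrite ltr_pM2l ?Hq // lt_neqAle eq_sym wq0 w0.
  apply: ler_sum => q _; have [->|wq] := eqVneq (w q) 0; first by rewrite !mul0r.
  by rewrite ler_wpM2l // ltW // Hq.
have Y0 : 0 <= \sum_v y v by apply: sumr_ge0.
have h4 := ler_wpM2r Y0 totN.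
by have := lt_le_trans (le_lt_trans h4 h3) h2; rewrite ltxx.
Qed.

End CliqueTiling.

(** * Sampling *)

Lemma natr_card (R : numDomainType) (T : finType) (P : pred T) :
  #|[set u | P u]|%:R = \sum_u (P u)%:R :> R.
Proof.
rewrite cardsE -sum1_card natr_sum [RHS](bigID P) /= [X in _ + X]big1 ?addr0.
  by apply: eq_bigr => u; rewrite unfold_in => ->.
by move=> u /negPf ->.
Qed.

Section Sampling.

Variables (R : realFieldType) (X : finType) (M : nat).
Local Notation samples := {ffun 'I_M -> X}.
Local Notation N := (#|X|%:R : R).

Definition resample (phi : samples) (j : 'I_M) (v : X) : samples :=
  [ffun i => if i == j then v else phi i].

(** The pair of a sample and a new vertex is subject to an involution: exchange the new vertex with
    coordinate [j]. *)
Lemma sum_resample (K : samples -> R) (j : 'I_M) :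
  \sum_phi \sum_v K (resample phi j v) = N * \sum_phi K phi.
Proof.
rewrite pair_big /=.
pose swap (p : samples * X) := (resample p.1 j p.2, p.1 j).
have swapK : involutive swap.
  move=> [phi v]; rewrite /swap /=; congr pair; last by rewrite ffunE eqxx.
  apply/ffunP => i; rewrite !ffunE.
  by case: (eqVneq i j) => [->|].
rewrite (reindex_inj (inv_inj swapK)) /=.
rewrite (eq_bigr (fun p => K p.1)) => [|[phi v] _]; last first.
  by rewrite -[phi in RHS](congr1 fst (swapK (phi, v))).
rewrite -(pair_big xpredT xpredT (fun phi (v : X) => K phi)) /= mulr_sumr.
by apply: eq_bigr => phi _; rewrite sumr_const mulr_natl.
Qed.

Variable k : X -> X -> R.
Hypothesis k_mean : forall v, \sum_u k v u = 0.
Hypothesis k_bound : forall v u, `|k v u| <= 1.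
Hypothesis X_gt0 : (0 < #|X|)%N.

Definition deviation (phi : samples) (i : 'I_M) : R :=
  \sum_(j | j != i) k (phi i) (phi j).

(** A second moment bound, with counts in place of probabilities. Resampling coordinate [j] shows
    that the mixed terms vanish, and each diagonal term is at most 1. *)
Lemma sum_sq_deviation i :
  \sum_phi deviation phi i ^+ 2 <= M%:R * N ^+ M.
Proof.
have card_samples : \sum_(phi : samples) 1 = N ^+ M.
  by rewrite sumr_const card_ffun card_ord natrX.
have -> : \sum_phi deviation phi i ^+ 2 = \sum_(j | j != i) \sum_(j' | j' != i)
    \sum_(phi : samples) k (phi i) (phi j) * k (phi i) (phi j').
  rewrite [RHS](eq_bigr (fun j => \sum_(phi : samples) \sum_(j' | j' != i)
    k (phi i) (phi j) * k (phi i) (phi j'))) => [|j _]; last by rewrite exchange_big.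
  rewrite exchange_big /=; apply: eq_bigr => phi _.
  by rewrite expr2 big_distrl /=; apply: eq_bigr => j _; rewrite mulr_sumr.
have offdiag j j' : j != i -> j' != j ->
    \sum_(phi : samples) k (phi i) (phi j) * k (phi i) (phi j') = 0.
  move=> ji j'j; apply: (@mulfI _ N); first by rewrite pnatr_eq0 -lt0n.
  rewrite mulr0 -(sum_resample _ j) big1 // => phi _.
  rewrite (eq_bigr (fun v => k (phi i) v * k (phi i) (phi j'))) => [|v _].
    by rewrite -mulr_suml k_mean mul0r.
  by rewrite !ffunE eqxx (negPf j'j) [i == j]eq_sym (negPf ji).
apply: (@le_trans _ _ (\sum_(j | j != i) N ^+ M)).
  apply: ler_sum => j ji; rewrite (bigD1 j) //= [X in _ + X]big1 ?addr0.
    rewrite -card_samples; apply: ler_sum => phi _.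
    apply: le_trans (ler_norm _) _; rewrite normrM.
    by rewrite mulr_ile1.
  by move=> j' /andP[_ j'j]; apply: offdiag.
rewrite sumr_const -[_ *+ _]mulr_natl ler_wpM2r ?exprn_ge0 //.
rewrite ler_nat; apply: leq_trans (max_card _) _; by rewrite card_ord.
Qed.

Variable z : R.
Hypothesis z_gt0 : 0 < z.

Definition outliers (phi : samples) : {set 'I_M} :=
  [set i | z * M%:R < deviation phi i].

(** Markov's inequality: a bad sample has at least [z * M] outliers, each with squared deviation
    above [(z * M)^2], while the total over all samples is at most [M^2 * N^M]. *)
Lemma few_bad_samples :
  #|[set phi | z * M%:R <= #|outliers phi|%:R]|%:R * (z ^+ 3 * M%:R) <= N ^+ M.
Proof.
have [M0|M0] := posnP M.
  have e0 : M%:R = 0 :> R by rewrite M0.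
  by rewrite [X in _ * (_ * X)]e0 !mulr0 exprn_ge0.
have Mp : 0 < M%:R :> R by rewrite ltr0n.
set bad := [set phi | _].
have zM : 0 < z * M%:R by rewrite mulr_gt0.
have h1 : #|bad|%:R * (z * M%:R) ^+ 3 <= \sum_phi \sum_i deviation phi i ^+ 2.
  apply: (@le_trans _ _ (\sum_(phi in bad) \sum_i deviation phi i ^+ 2)); last first.
    rewrite [leRHS](bigID (mem bad)) /= lerDl; apply: sumr_ge0 => phi _.
    by apply: sumr_ge0 => i _; exact: sqr_ge0.
  rewrite mulr_natl -sumr_const; apply: ler_sum => phi; rewrite inE => hphi.
  apply: (@le_trans _ _ (\sum_(i in outliers phi) (z * M%:R) ^+ 2)).
    by rewrite sumr_const -[leRHS]mulr_natl exprS ler_wpM2r // sqr_ge0.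
  rewrite [leRHS](bigID (mem (outliers phi))) /= -[leLHS]addr0 lerD //.
    apply: ler_sum => i; rewrite inE => /ltW hi.
    by rewrite lerXn2r // nnegrE ?ltW // (lt_le_trans zM).
  by apply: sumr_ge0 => i _; exact: sqr_ge0.
have h2 : \sum_phi \sum_i deviation phi i ^+ 2 <= M%:R * (M%:R * N ^+ M).
  rewrite exchange_big /= mulr_natl -[X in _ *+ X](card_ord M) -sumr_const.
  by apply: ler_sum => i _; exact: sum_sq_deviation.
have := le_trans h1 h2.
rewrite (_ : _ * _ ^+ 3 = (M%:R * M%:R) * (#|bad|%:R * (z ^+ 3 * M%:R))); last by ring.
by rewrite [leRHS]mulrA ler_pM2l // mulr_gt0.
Qed.

End Sampling.

(** Each [t] is a test. A sample passes it if few of its indices [i] see a sum over the sample well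
    above the expected one. *)
Definition good_sample (R : realFieldType) (X T : finType) (M : nat) (z : R)
    (g : T -> X -> X -> R) (phi : {ffun 'I_M -> X}) : bool :=
  [forall t : T, #|[set i | (\sum_u g t (phi i) u) / #|X|%:R * M%:R
     + 2 * z * M%:R < \sum_j g t (phi i) (phi j)]|%:R < z * M%:R].

Lemma many_good_samples (R : realFieldType) (X T : finType) (M : nat) (z : R)
    (g : T -> X -> X -> R) :
  (0 < #|X|)%N -> 0 < z -> 2 * #|T|%:R <= z ^+ 3 * M%:R -> 1 <= z * M%:R ->
  (forall t v u, 0 <= g t v u <= 1) ->
  #|X|%:R ^+ M <= 2 * #|[set phi : {ffun 'I_M -> X} | good_sample z g phi]|%:R :> R.
Proof.
move=> X0 z0 TM zM g01.
pose good := @good_sample R X T M z g.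
set N : R := #|X|%:R; have N0 : 0 < N by rewrite ltr0n.
pose mean t v := (\sum_u g t v u) / N.
have mean01 t v : 0 <= mean t v <= 1.
  apply/andP; split.
    by rewrite divr_ge0 // sumr_ge0 // => u _; case/andP: (g01 t v u).
  rewrite ler_pdivrMr // mul1r -[N]mulr1 /N mulr_natl -sumr_const.
  by apply: ler_sum => u _; case/andP: (g01 t v u).
pose k t v u := g t v u - mean t v.
have k0 t v : \sum_u k t v u = 0.
  rewrite sumrB sumr_const -[_ *+ _]mulr_natr divfK ?subrr // gt_eqF //.
have k1 t v u : `|k t v u| <= 1.
  rewrite ler_norml /k; case/andP: (g01 t v u) (mean01 t v) => ? ? /andP[? ?].
  by apply/andP; split; lra.
pose bad t : {set {ffun 'I_M -> X}} :=
  [set phi | z * M%:R <= #|outliers (k t) z phi|%:R].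
have badP t : #|bad t|%:R * (z ^+ 3 * M%:R) <= N ^+ M.
  exact: few_bad_samples.
have sub : ~: [set phi | good phi] \subset \bigcup_t bad t.
  apply/subsetP => phi; rewrite !inE /good /good_sample negb_forall => /existsP[t].
  rewrite -leNgt => h; apply/bigcupP; exists t => //; rewrite inE.
  apply: le_trans h _; rewrite ler_nat; apply/subset_leq_card/subsetP => i.
  (* One of the two [z * M] pays for the diagonal term [j = i], absent from [deviation] and at most
     [1 <= z * M]. *)
  rewrite !inE => h; rewrite /deviation sumrB sumr_const.
  have -> : (#|[pred j | j != i]| = M.-1)%N by rewrite cardC1 card_ord.
  move: h; rewrite (bigD1 i) //= -/(mean t (phi i)).
  have M1 : M = M.-1.+1 by rewrite prednK // (leq_trans _ (ltn_ord i)).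
  have ME : M%:R = M.-1%:R + 1 :> R by rewrite natr1 prednK // M1.
  rewrite -[mean _ _ *+ _]mulr_natl; move: zM; rewrite ME.
  case/andP: (g01 t (phi i) (phi i)) (mean01 t (phi i)) => _ g1 /andP[m0 m1].
  by lra.
have cardsum : (#|\bigcup_t bad t| <= \sum_t #|bad t|)%N.
  elim/big_ind2: _ => [|a A b B ha hb|t _]; rewrite ?cards0 //.
  by apply: leq_trans _ (leq_add ha hb); rewrite cardsU leq_subr.
have tot : N ^+ M = #|[set phi | good phi]|%:R + #|~: [set phi | good phi]|%:R :> R.
  by rewrite -natrD cardsC card_ffun card_ord natrX.
have h : #|~: [set phi | good phi]|%:R * (z ^+ 3 * M%:R) <= #|T|%:R * N ^+ M :> R.
  apply: (@le_trans _ _ ((\sum_t #|bad t|%:R) * (z ^+ 3 * M%:R))).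
    rewrite ler_wpM2r //; first by apply: le_trans TM; rewrite mulr_ge0.
    by rewrite -natr_sum ler_nat (leq_trans (subset_leq_card sub)).
  by rewrite mulr_suml mulr_natl -sumr_const; apply: ler_sum => t _; exact: badP.
have zM3 : 0 < z ^+ 3 * M%:R.
  have : 0 < z * M%:R by apply: lt_le_trans zM.
  by rewrite pmulr_rgt0 // => Mp; rewrite mulr_gt0 // exprn_gt0.
have h2 : 2 * #|~: [set phi | good phi]|%:R * (z ^+ 3 * M%:R) <= (z ^+ 3 * M%:R) * N ^+ M :> R.
  apply: le_trans (_ : _ <= 2 * #|T|%:R * N ^+ M) _; first by move: h; lra.
  by rewrite ler_wpM2r // exprn_ge0 // ltW.
by move: h2; rewrite mulrC ler_pM2l // tot; lra.
Qed.

Lemma card_comp_inj (X : finType) (M r : nat) (iota : 'I_r -> 'I_M)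
    (Q : {set {ffun 'I_r -> X}}) : injective iota ->
  (#|[set phi : {ffun 'I_M -> X} | [ffun i => phi (iota i)] \in Q]|
     <= #|Q| * #|X| ^ (M - r))%N.
Proof.
move=> inj_i.
have -> : [set phi : {ffun 'I_M -> X} | [ffun i => phi (iota i)] \in Q] =
   \bigcup_(psi in Q) [set phi : {ffun 'I_M -> X} | [ffun i => phi (iota i)] == psi].
  apply/setP => phi; rewrite inE; apply/idP/bigcupP => [H|[psi pQ]].
    by exists [ffun i => phi (iota i)]; rewrite ?inE.
  by rewrite inE => /eqP ->.
apply: (@leq_trans (\sum_(psi in Q) #|X| ^ (M - r))%N); last first.
  by rewrite sum_nat_const.
apply: (@leq_trans (\sum_(psi in Q)
    #|[set phi : {ffun 'I_M -> X} | [ffun i => phi (iota i)] == psi]|)%N).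
  elim/big_ind2: _ => [|a A b B ha hb|t _]; rewrite ?cards0 //.
  by apply: leq_trans _ (leq_add ha hb); rewrite cardsU leq_subr.
apply: leq_sum => psi _.
pose F (i : 'I_M) := [pred v | [forall l, (iota l == i) ==> (v == psi l)]].
apply: (@leq_trans #|family F|).
  apply/subset_leq_card/subsetP => phi; rewrite !inE => /eqP/ffunP H.
  apply/familyP => i; rewrite inE; apply/forallP => l; apply/implyP => /eqP <-.
  by rewrite -H ffunE.
rewrite card_family foldrE big_map big_enum /=.
rewrite (bigID (fun i => i \in codom iota)) /=.
apply: (@leq_trans (1 * \prod_(i | i \notin codom iota) #|X|))%N.
  apply: leq_mul.
    suff : (\prod_(i in codom iota) #|F i| <= \prod_(i in codom iota) 1)%N.
      by rewrite prod_nat_const exp1n.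
    apply: leq_prod => i /codomP[l ->].
    rewrite -(card1 (psi l)); apply/subset_leq_card/subsetP => v.
    by rewrite !inE => /forallP /(_ l); rewrite eqxx.
  by apply: leq_prod => i _; exact: max_card.
rewrite mul1n prod_nat_const leq_eqVlt; apply/orP; left; apply/eqP; congr (_ ^ _)%N.
rewrite -[X in (X - _)%N](card_ord M) -(cardC (mem (codom iota))).
by rewrite card_codom // card_ord addKn.
Qed.

Lemma nat_upper_bound (R : realType) (x : R) : exists n : nat, x <= n%:R.
Proof.
have [x0|x0] := leP x 0; first by exists 0%N.
by exists (Num.Def.archi_bound x); rewrite ltW // archi_boundP // ltW.
Qed.

(** A good sample of bounded size [M] contains a cheap clique, and each tuple of [Q] arises from few
    samples, so [Q] is dense. Degree ranks are rounded to [L] classes to keep the number of tests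
    independent of [X]. *)
Lemma many_cheap_cliques (R : realType) (s L : nat) (al be ga xi de : R) :
  (0 < s)%N -> 0 < al -> al < be -> al + s%:R * be = 1 ->
  0 <= xi -> xi < ga -> ga <= 1 -> 0 < de -> de <= 1 ->
  exists2 c : R, 0 < c &
  forall (X : finType) (e : rel X) (cls : X -> 'I_L) (y : X -> R),
  symmetric e -> irreflexive e -> (0 < #|X|)%N ->
  (forall v, 0 <= y v <= 1) ->
  (forall k : 'I_L, \sum_u (cls u <= k)%N%:R <= (k%:R / L%:R + xi) * #|X|%:R) ->
  (forall v, \sum_u (~~ e v u)%:R <=
     (be + al * Num.max 0 (1 - (cls v)%:R / L%:R / be) - ga) * #|X|%:R) ->
  c * #|X|%:R ^+ s.+1 <= #|[set q : {ffun 'I_s.+1 -> X} | is_clique e q &&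
     (\sum_i role_weight al be i * y (q i) <= (\sum_v y v) / #|X|%:R + de)]|%:R.
Proof.
move=> s0 al0 alb albe xi0 xiga ga1 de0 de1.
have be0 : 0 < be by apply: lt_trans alb.
have s1 : 1 <= s%:R :> R by rewrite ler1n.
have albe1 : al + be <= 1 by rewrite -albe lerD2l ler_peMl // ltW.
(* Sampling costs [2 * z] and deleting outliers another [4 * z]. So [ga] falls and [xi] rises by
   [6 * z], and [12 * z <= ga - xi] keeps them in order. *)
pose z := Num.min (de / 4) ((ga - xi) / 12).
have z0 : 0 < z by rewrite lt_min !divr_gt0 ?subr_gt0.
have zde : 4 * z <= de.
  have : z <= de / 4 by rewrite /z ge_min lexx.
  lra.
have zga : 12 * z <= ga - xi.
  have : z <= (ga - xi) / 12 by rewrite /z ge_min lexx orbT.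
  lra.
pose T := option (option 'I_L).
have [M0 hM0] := nat_upper_bound (2 * #|{: T}|%:R / z ^+ 3).
have [M1 hM1] := nat_upper_bound (z^-1).
pose M := (M0 + M1 + s.+1)%N.
have hM a : (a <= M)%N -> a%:R <= M%:R :> R by rewrite ler_nat.
have Mp : 0 < M%:R :> R by rewrite ltr0n /M addnS.
have MT : 2 * #|{: T}|%:R <= z ^+ 3 * M%:R.
  rewrite [leRHS]mulrC -ler_pdivrMr ?exprn_gt0 //.
  by apply: (le_trans hM0); apply: hM; rewrite /M -addnA leq_addr.
have zM : 1 <= z * M%:R.
  rewrite -ler_pdivrMl // mulr1; apply: (le_trans hM1); apply: hM.
  by rewrite /M addnAC leq_addl.
have sM : (s.+1 <= M)%N by rewrite /M leq_addl.
exists (2 * M%:R ^+ s.+1)^-1; first by rewrite invr_gt0 mulr_gt0 ?exprn_gt0.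
move=> X e cls y e_sym e_irr X0 y01 rank miss.
set N : R := #|X|%:R; have N0 : 0 < N by rewrite ltr0n.
pose g (t : T) (v u : X) : R := match t with
  | None => (~~ e v u)%:R | Some None => y u | Some (Some k) => (cls u <= k)%N%:R end.
have g01 t v u : 0 <= g t v u <= 1.
  by case: t => [[k|]|] //=; rewrite ler0n lern1; exact: leq_b1.
have many := @many_good_samples R X _ M z g X0 z0 MT zM g01.
set good := [set phi | _] in many.
set Q := [set q | _].
suff sub : good \subset \bigcup_(iota in [set f : {ffun 'I_s.+1 -> 'I_M} | injectiveb f])
    [set phi : {ffun 'I_M -> X} | [ffun i => phi (iota i)] \in Q].
  have h : (#|good| <= M ^ s.+1 * (#|Q| * #|X| ^ (M - s.+1)))%N.
    apply: leq_trans (subset_leq_card sub) _.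
    apply: (@leq_trans (\sum_(iota in [set f : {ffun 'I_s.+1 -> 'I_M} | injectiveb f])
        (#|Q| * #|X| ^ (M - s.+1)))%N).
      elim/big_ind2: _ => [|a A b B ha hb|f]; rewrite ?cards0 //.
        by apply: leq_trans _ (leq_add ha hb); rewrite cardsU leq_subr.
      by rewrite inE => /injectiveP inj_f; exact: card_comp_inj.
    rewrite sum_nat_const leq_mul2r; apply/orP; right.
    by apply: leq_trans (max_card _) _; rewrite card_ffun !card_ord.
  rewrite -(ler_nat R) natrM natrX natrM natrX -/N in h.
  have := le_trans many (ler_wpM2l (ler0n _ 2) h).
  rewrite -[in X in X <= _](subnK sM) exprD.
  rewrite (_ : 2 * _ = N ^+ (M - s.+1) * (2 * M%:R ^+ s.+1 * #|Q|%:R)); last by ring.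
  rewrite ler_pM2l ?exprn_gt0 // => h'.
  by rewrite mulrC ler_pdivrMr ?mulr_gt0 ?exprn_gt0 // mulrC.
apply/subsetP => phi; rewrite inE => /forallP gphi.
pose out t := [set i | (\sum_u g t (phi i) u) / N * M%:R + 2 * z * M%:R
   < \sum_j g t (phi i) (phi j)].
have outz t : #|out t|%:R < z * M%:R by exact: gphi.
have outP t i : i \notin out t -> \sum_j g t (phi i) (phi j) <=
    (\sum_u g t (phi i) u) / N * M%:R + 2 * z * M%:R.
  by rewrite inE -leNgt.
have z1 : z <= 1 / 4 by move: zde de1; clear; lra.
have inP t : exists i, i \notin out t.
  apply/existsP; rewrite -negb_forall; apply/forallP => H.
  have : M%:R <= #|out t|%:R :> R.
    rewrite ler_nat -[X in (X <= _)%N]card_ord -cardsT.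
    by apply/subset_leq_card/subsetP => i _; exact: H.
  have := ler_wpM2r (ltW Mp) z1; have := outz t; move: Mp; clear; lra.
(* For the rank and cost tests [g] ignores its base point, so one index that is not an outlier is
   enough. *)
have rank' (k : 'I_L) : \sum_j (cls (phi j) <= k)%N%:R <= (k%:R / L%:R + xi + 2 * z) * M%:R.
  have [i /outP /= /le_trans -> //] := inP (Some (Some k)).
  rewrite [leRHS]mulrDl lerD2r ler_wpM2r ?(ltW Mp) //.
  by rewrite ler_pdivrMr // rank.
have avg' : \sum_j y (phi j) <= ((\sum_v y v) / N + 2 * z) * M%:R.
  have [i /outP] := inP (Some None); rewrite /= => h.
  by apply: le_trans h _; rewrite [leRHS]mulrDl.
(* The outliers for the number of non-neighbours are deleted. The resulting graph lives on indices,
   so a vertex sampled twice gives two nonadjacent points. *)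
pose A := [pred i | i \notin out None].
pose Y := {i : 'I_M | i \in A}.
have cY : #|{: Y}| = #|~: out None|.
  by rewrite card_sig; apply: eq_card => i; rewrite !inE.
have cY1 : (1 - z) * M%:R <= #|{: Y}|%:R.
  have : #|out None|%:R + #|{: Y}|%:R = M%:R :> R.
    by rewrite cY -natrD cardsC card_ord.
  have := outz None; lra.
have cY2 : #|{: Y}|%:R <= M%:R :> R.
  by rewrite ler_nat cY; apply: leq_trans (max_card _) _; rewrite card_ord.
have cY0 : (0 < #|{: Y}|)%N.
  rewrite -(ltr0n R); apply: lt_le_trans cY1; rewrite mulr_gt0 //; move: z1; clear; lra.
set K : R := #|{: Y}|%:R in cY1 cY2.
have K0 : 0 < K by rewrite ltr0n.
pose e' : rel Y := fun i j => e (phi (val i)) (phi (val j)).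
have sumY (f : 'I_M -> R) : (forall j, 0 <= f j) -> \sum_(j : Y) f (val j) <= \sum_j f j.
  move=> f0; rewrite -(big_sub A) [leRHS](bigID A) /= lerDl.
  exact: sumr_ge0.
(* Replacing [M] by [K >= (1 - z) * M] costs at most [4 * z] for densities up to 2. If the enlarged
   density is still negative, [loss] uses [K <= M] instead. *)
have lossy a : a <= 2 -> a * M%:R <= (a + 4 * z) * K \/ a + 4 * z < 0.
  move=> a2; have [h|h] := leP 0 (a + 4 * z); [left|by right].
  have := ler_wpM2l h cY1; apply: le_trans.
  rewrite mulrA ler_wpM2r ?(ltW Mp) //.
  have : 0 <= z * (2 - a) by rewrite mulr_ge0 ?subr_ge0 // ltW.
  have : 0 <= z * (1/4 - z) by rewrite mulr_ge0 ?subr_ge0 // ltW.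
  move: z0; clear; lra.
have loss a b : a <= 2 -> b = a + 4 * z -> a * M%:R <= b * K.
  move=> a2 ->; case: (lossy a a2) => // h.
  apply: (@le_trans _ _ ((a + 4 * z) * M%:R)).
    by rewrite ler_wpM2r ?(ltW Mp) // lerDl mulr_ge0 // ltW.
  by rewrite ler_wnM2l // ltW.
have cls1 (k : 'I_L) : 0 <= (k%:R / L%:R : R) <= 1.
  have L0 : (0 < L)%N by apply: leq_trans (ltn_ord k).
  by rewrite divr_ge0 //= ler_pdivrMr ?ltr0n // mul1r ler_nat ltnW.
pose rho (v : Y) : R := (cls (phi (val v)))%:R / L%:R.
have e'_sym : symmetric e' by move=> i j; rewrite /e' e_sym.
have e'_irr : irreflexive e' by move=> i; rewrite /e' e_irr.
have [|||||q cq hq] := @cheap_clique R Y e' s al be e'_sym e'_irr s0 al0 alb albe rho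
   (ga - 6 * z) (xi + 6 * z) (fun v => y (phi (val v))) cY0.
- by move=> v; case/andP: (cls1 (cls (phi (val v)))).
- by apply/andP; split; [rewrite addr_ge0 ?mulr_ge0 // ltW|move: zga; clear; lra].
- move=> v; set k := cls (phi (val v)).
  have L0 : (0 < L)%N by apply: leq_trans (ltn_ord k).
  apply: (@le_trans _ _ (\sum_j (cls (phi j) <= k)%N%:R)).
    have := sumY (fun j => (cls (phi j) <= k)%N%:R) (fun j => ler0n _ _).
    apply: le_trans; apply: ler_sum => u _.
    have -> // : (rho u <= rho v) = (cls (phi (val u)) <= k)%N.
    by rewrite /rho ler_pM2r ?invr_gt0 ?ltr0n // ler_nat.
  apply: le_trans (rank' k) (loss _ _ _ _); last by rewrite /rho -/k; ring.
  by case/andP: (cls1 k); move: zga xi0 z0 ga1; clear; lra.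
- move=> v.
  apply: (@le_trans _ _ (\sum_j g None (phi (val v)) (phi j))).
    exact: (sumY (fun j => g None (phi (val v)) (phi j)) (fun j => ler0n _ _)).
  have vA : val v \notin out None := valP v.
  apply: le_trans (outP _ _ vA) _.
  set B := be + al * Num.max 0 (1 - rho v / be).
  have hB : (\sum_u g None (phi (val v)) u) / N <= B - ga.
    by rewrite ler_pdivrMr //; exact: miss.
  have hB1 : B <= 1.
    apply: le_trans albe1; rewrite /B addrC lerD2r -[leRHS]mulr1 ler_pM2l //.
    rewrite ge_max ler01 /= gerBl divr_ge0 ?(ltW be0) //.
    by case/andP: (cls1 (cls (phi (val v)))).
  apply: (@le_trans _ _ ((B - ga + 2 * z) * M%:R)).
    by rewrite -mulrDl ler_wpM2r ?(ltW Mp) // lerD2r.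
  apply: loss; last by rewrite -/B; ring.
  by move: hB1 z1 ga1 xi0 xiga; clear; lra.
- by move=> v; case/andP: (y01 (phi (val v))).
apply/bigcupP; exists [ffun i => val (q i)].
  rewrite inE; apply/injectiveP => i j; rewrite !ffunE => /val_inj qij.
  apply/eqP; apply: contraT => /(elimT (is_cliqueP _ _) cq).
  by rewrite qij /e' e_irr.
rewrite !inE; apply/andP; split.
  apply/is_cliqueP => i j ij; rewrite !ffunE.
  exact: (elimT (is_cliqueP _ _) cq).
under eq_bigr do rewrite !ffunE.
rewrite -(ler_pM2l K0); apply: le_trans hq _.
have := sumY (fun j => y (phi j)) (fun j => _).
move=> /(_ _)/le_trans; apply; first by move=> j; case/andP: (y01 (phi j)).
apply: le_trans avg' _; set av := _ / N.
have av1 : av <= 1.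
  rewrite /av ler_pdivrMr // mul1r /N -sumr_const.
  by apply: ler_sum => u _; case/andP: (y01 u).
apply: (@le_trans _ _ ((av + de) * ((1 - z) * M%:R))); last first.
  rewrite mulrC ler_wpM2r // addr_ge0 ?(ltW de0) // divr_ge0 ?(ltW N0) // sumr_ge0 // => v _.
  by case/andP: (y01 v).
rewrite mulrA ler_wpM2r ?(ltW Mp) //.
have : z * (av + de) <= z * 2 by rewrite ler_wpM2l ?(ltW z0) //; move: av1 de1; clear; lra.
move: zde; clear; lra.
Qed.

(** * Cheap bottles *)

(** The points of [T] are chosen one by one. Outside the points chosen so far each [A p] keeps
    density [c / 2], so by averaging some new point lies in [A p] for a proportion [c / 4] of the
    surviving [p]. *)
Lemma common_subset (R : realFieldType) (X Y : finType) (A : Y -> {set X})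
    (P : {set Y}) (c : R) (t : nat) :
  0 < c -> (0 < #|P|)%N -> 2 * t%:R <= c * #|X|%:R ->
  (forall p, p \in P -> c * #|X|%:R <= #|A p|%:R) -> (0 < #|X|)%N ->
  exists (T : {set X}) (P' : {set Y}),
    [/\ #|T| = t, (0 < #|P'|)%N, (c / 4) ^+ t * #|P|%:R <= #|P'|%:R,
        P' \subset P & forall p, p \in P' -> T \subset A p].
Proof.
move=> c0 P0; elim: t => [|t IH] tX AP X0.
  exists set0, P; split; rewrite ?cards0 ?expr0 ?mul1r //.
  by move=> p _; exact: sub0set.
have tX' : 2 * t%:R <= c * #|X|%:R by apply: le_trans tX; rewrite ler_wpM2l // ler_nat.
have [T [P' [cT P'0 cP' P'P TA]]] := IH tX' AP X0.
pose f x : nat := #|[set p in P' | x \in A p]|.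
have [x xT hfx] : exists2 x, x \notin T & c / 4 * #|P'|%:R <= (f x)%:R.
  suff /existsP[x /andP[xT fx]] : [exists x, (x \notin T) &&
    (c / 4 * #|P'|%:R <= (f x)%:R)] by exists x.
  apply: contraT; rewrite negb_exists => /forallP H.
  have h1 : \sum_(x | x \notin T) (f x)%:R <= #|X|%:R * (c / 4 * #|P'|%:R).
    apply: (@le_trans _ _ (\sum_(x : X) c / 4 * #|P'|%:R)); last first.
      by rewrite sumr_const -[leLHS]mulr_natl.
    rewrite [leRHS](bigID (fun x => x \notin T)) /= -[leLHS]addr0 lerD //.
      by apply: ler_sum => x xT; have := H x; rewrite xT /= -ltNge => /ltW.
    by apply: sumr_ge0 => x _; rewrite mulr_ge0 // divr_ge0 // ltW.
  have h2 : \sum_(x | x \notin T) (f x)%:R = \sum_(p in P') #|A p :\: T|%:R :> R.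
    transitivity (\sum_(x | x \notin T) \sum_(p in P') (x \in A p)%:R : R).
      apply: eq_bigr => x _; rewrite /f -sum1_card natr_sum.
      rewrite [RHS](bigID (fun p => x \in A p)) /= [X in _ + X]big1 ?addr0.
        under eq_bigl do rewrite inE.
        by apply: eq_bigr => p /andP[_ ->].
      by move=> p /andP[_ /negPf ->].
    rewrite exchange_big /=; apply: eq_bigr => p _.
    rewrite -sum1_card natr_sum [LHS](bigID (fun x => x \in A p)) /= [X in _ + X]big1 ?addr0.
      by under [RHS]eq_bigl do rewrite inE; apply: eq_bigr => x /andP[_ ->].
    by move=> x /andP[_ /negPf ->].
  have h3 : #|P'|%:R * (c / 2 * #|X|%:R) <= \sum_(p in P') #|A p :\: T|%:R :> R.
    rewrite mulr_natl -sumr_const; apply: ler_sum => p pP.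
    have : #|A p|%:R <= #|A p :\: T|%:R + t%:R :> R.
      rewrite -natrD ler_nat -cT -(cardsID T (A p)) addnC leq_add2l.
      by apply/subset_leq_card/subsetIr.
    have := AP p (subsetP P'P _ pP); move: tX'; lra.
  have h4 : 0 < #|P'|%:R * (c * #|X|%:R) by rewrite !mulr_gt0 // ltr0n.
  move: h1 h3; rewrite h2; lra.
exists (x |: T), [set p in P' | x \in A p]; split.
- by rewrite cardsU1 xT cT.
- rewrite -(ltr0n R); apply: lt_le_trans hfx; rewrite !mulr_gt0 ?invr_gt0 ?ltr0n //.
- apply: le_trans hfx; rewrite exprS -mulrA ler_wpM2l //.
  by rewrite divr_ge0 // ltW.
- by apply: subset_trans P'P; apply/subsetP => p; rewrite inE => /andP[].
- move=> p; rewrite inE => /andP[pP xA]; rewrite subUset sub1set xA /=.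
  exact: TA.
Qed.

Definition ffun_cons (X : Type) (r : nat) (p : X * {ffun 'I_r -> X}) : {ffun 'I_r.+1 -> X} :=
  [ffun i => if unlift ord0 i is Some j then p.2 j else p.1].

Definition ffun_uncons (X : Type) (r : nat) (q : {ffun 'I_r.+1 -> X}) :=
  (q ord0, [ffun j => q (lift ord0 j)]).

Lemma ffun_consK (X : Type) r : cancel (@ffun_cons X r) (@ffun_uncons X r).
Proof.
move=> [x p]; rewrite /ffun_uncons /ffun_cons !ffunE unlift_none /=; congr pair.
by apply/ffunP => j; rewrite !ffunE liftK.
Qed.

Lemma ffun_unconsK (X : Type) r : cancel (@ffun_uncons X r) (@ffun_cons X r).
Proof.
move=> q; apply/ffunP => i; rewrite !ffunE /=.
by case: unliftP => [j ->|->]; rewrite ?ffunE.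
Qed.

(** Erdős's theorem that a dense [r]-partite [r]-graph contains complete [r]-partite ones, by
    induction on [r]: at least [c2 * #|X|^(r-1)] of the shorter tuples have [c2 * #|X|] extensions
    each, [common_subset] gives many of them a common set of extensions, and the induction
    hypothesis applies to those. *)
Lemma dense_box (R : realType) (r : nat) (t : 'I_r -> nat) (c : R) :
  0 < c ->
  exists n0 : nat, forall (X : finType) (Q : {set {ffun 'I_r -> X}}),
    (n0 <= #|X|)%N -> c * #|X|%:R ^+ r <= #|Q|%:R ->
    exists T : 'I_r -> {set X}, (forall i, #|T i| = t i) /\
      (forall q : {ffun 'I_r -> X}, (forall i, q i \in T i) -> q \in Q).
Proof.
elim: r t c => [|r IH] t c c0.
  exists 0%N => X Q _; rewrite expr0 mulr1 => cQ.
  have /card_gt0P[q0 q0Q] : (0 < #|Q|)%N by rewrite -(ltr0n R); apply: lt_le_trans cQ.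
  exists (fun=> set0); split => [[]//|q _].
  by rewrite (_ : q = q0) //; apply/ffunP => -[].
pose c2 := c / 2; have c20 : 0 < c2 by rewrite divr_gt0.
have c'0 : 0 < (c2 / 4) ^+ t ord0 * c2 by rewrite mulr_gt0 // exprn_gt0 // divr_gt0.
have [n1 hn1] := IH (fun i => t (lift ord0 i)) _ c'0.
have [n2 hn2] := nat_upper_bound (2 * (t ord0)%:R / c2).
exists (n1 + n2 + 1)%N => X Q nX cQ.
have X0 : (0 < #|X|)%N by apply: leq_trans nX; rewrite addn1.
pose A (p : {ffun 'I_r -> X}) := [set x | ffun_cons (x, p) \in Q].
pose P := [set p | c2 * #|X|%:R <= #|A p|%:R].
have QE : #|Q|%:R = \sum_p #|A p|%:R :> R.
  have -> : #|Q|%:R = \sum_q (q \in Q)%:R :> R.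
    by rewrite -natr_card; congr _%:R; apply: eq_card => q; rewrite inE.
  rewrite (reindex (@ffun_cons X r)) /=; last first.
    by exists (@ffun_uncons X r) => ? _; rewrite ?ffun_consK ?ffun_unconsK.
  rewrite -(pair_big xpredT xpredT (fun x p => (ffun_cons (x, p) \in Q)%:R)) /=.
  by rewrite exchange_big /=; apply: eq_bigr => p _; rewrite natr_card.
have N0 : 0 < #|X|%:R :> R by rewrite ltr0n.
have cP : c2 * #|X|%:R ^+ r <= #|P|%:R.
  have h : #|Q|%:R <= #|X|%:R * #|P|%:R + #|X|%:R ^+ r * (c2 * #|X|%:R).
    rewrite QE (bigID (mem P)) /= lerD //.
      rewrite mulrC mulr_natl -sumr_const; apply: ler_sum => p _.
      by rewrite ler_nat max_card.
    apply: (@le_trans _ _ (\sum_(p : {ffun 'I_r -> X}) c2 * #|X|%:R)).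
      rewrite [leRHS](bigID (mem P)) /= -[leLHS]add0r lerD //.
        by apply: sumr_ge0 => p _; rewrite mulr_ge0 // ltW.
      by apply: ler_sum => p; rewrite inE -ltNge => /ltW.
    by rewrite sumr_const card_ffun card_ord -[leLHS]mulr_natl natrX.
  rewrite -(ler_pM2l N0); have := le_trans cQ h; rewrite exprS.
  have cE : c = c2 + c2 by rewrite /c2; lra.
  rewrite [in X in X -> _]cE; set Nr := _ ^+ r; lra.
have P0 : (0 < #|P|)%N.
  by rewrite -(ltr0n R); apply: lt_le_trans cP; rewrite mulr_gt0 // exprn_gt0.
have tX : 2 * (t ord0)%:R <= c2 * #|X|%:R.
  have h : 2 * (t ord0)%:R / c2 <= #|X|%:R.
    by apply: (le_trans hn2); rewrite ler_nat (leq_trans _ nX) // addnAC leq_addl.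
  by rewrite ler_pdivrMr // [leRHS]mulrC in h.
have [|T0 [P' [cT0 P'0 cP' P'P TA]]] := @common_subset R X _ A P c2 _ c20 P0 tX _ X0.
  by move=> p; rewrite inE.
have [||T' [cT' T'P]] := hn1 X P'.
- by apply: leq_trans nX; rewrite -addnA leq_addr.
- apply: le_trans cP'; rewrite -mulrA ler_wpM2l // exprn_ge0 // divr_ge0 // ltW //.
exists (fun i => if unlift ord0 i is Some j then T' j else T0); split.
  by move=> i; case: unliftP => [j ->|->].
move=> q qT; rewrite -[q]ffun_unconsK.
have qP : (ffun_uncons q).2 \in P'.
  by apply: T'P => j; rewrite ffunE; have := qT (lift ord0 j); rewrite liftK.
have := subsetP (TA _ qP) (q ord0); rewrite inE; apply.
by have := qT ord0; rewrite unlift_none.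
Qed.

Lemma cheap_bottle (R : realType) (s L a b : nat) (ga xi de : R) :
  let m := (a + s * b)%N in
  let al := a%:R / m%:R in let be := b%:R / m%:R in
  (0 < s)%N -> (0 < a < b)%N ->
  0 <= xi -> xi < ga -> ga <= 1 -> 0 < de -> de <= 1 ->
  exists n0 : nat,
  forall (X : finType) (e : rel X) (cls : X -> 'I_L) (y : X -> R),
  symmetric e -> irreflexive e -> (n0 <= #|X|)%N ->
  (forall v, 0 <= y v <= 1) ->
  (forall k : 'I_L, \sum_u (cls u <= k)%N%:R <= (k%:R / L%:R + xi) * #|X|%:R) ->
  (forall v, \sum_u (~~ e v u)%:R <=
     (be + al * Num.max 0 (1 - (cls v)%:R / L%:R / be) - ga) * #|X|%:R) ->
  exists B : {set X}, [/\ is_bottle e s a b B, #|B| = m &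
    \sum_(u in B) y u <= m%:R * ((\sum_v y v) / #|X|%:R + de)].
Proof.
move=> m al be s0 /andP[a0 ab] xi0 xiga ga1 de0 de1.
have b0 : (0 < b)%N by apply: ltn_trans ab.
have m0 : (0 < m)%N by rewrite /m addn_gt0 a0.
have m0' : 0 < m%:R :> R by rewrite ltr0n.
have al0 : 0 < al by rewrite divr_gt0 // ltr0n.
have alb : al < be by rewrite ltr_pM2r ?invr_gt0 // ltr_nat.
have albe : al + s%:R * be = 1.
  by rewrite /al /be mulrA -mulrDl -natrM -natrD divff // gt_eqF.
have [c c0 many] := @many_cheap_cliques R s L al be ga xi de s0 al0 alb albe xi0 xiga ga1 de0 de1.
have [n1 hn1] := dense_box (@part_size s a b) c0.
exists (n1 + 1)%N => X e cls y e_sym e_irr nX y01 rank miss.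
have X0 : (0 < #|X|)%N by apply: leq_trans nX; rewrite addn1.
have hQ := many X e cls y e_sym e_irr X0 y01 rank miss.
have [|T [cT TQ]] := hn1 X _ _ hQ; first by apply: leq_trans nX; exact: leq_addr.
have T0 i : (0 < #|T i|)%N by rewrite cT /part_size; case: ifP.
(* [q] takes a dearest vertex from each part. It lies in the box, so it is cheap itself, and its
   cost bounds that of the whole bottle. *)
have [q qT qmax] : exists2 q : {ffun 'I_s.+1 -> X}, forall i, q i \in T i &
    forall i u, u \in T i -> y u <= y (q i).
  have /fin_all_exists2[q qT qmax] i : exists2 x, x \in T i & forall u, u \in T i -> y u <= y x.
    have /card_gt0P[x0 x0T] := T0 i.
    by case: (@Order.TotalTheory.arg_maxP _ R X x0 (mem (T i)) y x0T) => x ? ?; exists x.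
  by exists (finfun q) => i; rewrite ffunE; [exact: qT|exact: qmax].
have Te i j u v : i != j -> u \in T i -> v \in T j -> e u v.
  move=> ij uT vT; pose q' : {ffun 'I_s.+1 -> X} :=
    [ffun k => if k == i then u else if k == j then v else q k].
  have : q' \in [set q | is_clique e q && _] := TQ q' _.
  rewrite inE => /(_ _)/andP[].
    by move=> k; rewrite ffunE; case: eqP => [->|_] //; case: eqP => [->|_].
  move=> /is_cliqueP /(_ i j ij).
  by rewrite !ffunE !eqxx eq_sym (negPf ij).
have dT i j : i != j -> [disjoint T i & T j].
  move=> ij; rewrite disjoint_subset; apply/subsetP => u uT; rewrite !inE.
  by apply/negP => uT'; have := Te _ _ _ _ ij uT uT'; rewrite e_irr.
have psum : (\sum_(i < s.+1) part_size a b i = m)%N.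
  rewrite big_ord_recl {1}/part_size eqxx; congr (_ + _)%N.
  by rewrite (eq_bigr (fun=> b)) // sum_nat_const card_ord.
exists (\bigcup_i T i); split.
- by exists T; split.
- rewrite -sum1_card partition_disjoint_bigcup // -psum; apply: eq_bigr => i _.
  by rewrite sum1_card cT.
have := TQ q qT; rewrite inE => /andP[_ hq].
rewrite partition_disjoint_bigcup //; apply: le_trans (ler_wpM2l (ltW m0') hq).
rewrite mulr_sumr; apply: ler_sum => i _.
have -> : m%:R * (role_weight al be i * y (q i)) = #|T i|%:R * y (q i).
  rewrite cT /role_weight /part_size mulrA; congr (_ * _).
  by case: ifP => _; rewrite /al /be mulrC divfK // gt_eqF.
rewrite mulr_natl -sumr_const; apply: ler_sum => u uT; exact: qmax.
Qed.

(** * Greedy tiling with bottles *)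

Section GreedyTiling.
Import sequences exp.

Variable R : realType.

Lemma expR_le_quadratic (x : R) : `|x| <= 1 / 2 -> expR x <= 1 + x + 2 * x ^+ 2.
Proof.
rewrite ler_norml => /andP[x1 x2].
have h1 : 1 - x <= expR (- x) := expR_ge1Dx _.
have x3 : 0 < 1 - x by lra.
have h2 : 1 <= (1 - x) * (1 + x + 2 * x ^+ 2).
  have -> : (1 - x) * (1 + x + 2 * x ^+ 2) = 1 + x ^+ 2 * (1 - 2 * x) by ring.
  by rewrite lerDl mulr_ge0 ?sqr_ge0 //; lra.
have e0 := expR_gt0 x; have eN := expRxMexpNx_1 x.
have h3 : expR x * (1 - x) <= 1 by rewrite -[leRHS]eN ler_wpM2l // ltW.
have h4 := le_trans h3 h2.
by rewrite -(ler_pM2l x3) mulrC.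
Qed.

Lemma expR_mulN_le1 (x : R) : - x * expR x <= 1.
Proof.
have h1 : - x <= expR (- x).
  by apply: le_trans (expR_ge1Dx _); rewrite lerDr.
rewrite -[leRHS](expRxMexpNx_1 x) mulrC.
by rewrite ler_wpM2l // ltW // expR_gt0.
Qed.

Variables (X I : finType) (A : I -> {set X}) (P : {set X} -> Prop) (m : nat).
Variables (eta th de lam : R).
Local Notation n := #|X|.
Local Notation N := (#|X|%:R : R).

(** The amount by which [A i :&: S] falls short of its proportional share of [S]. *)
Definition deficit (S : {set X}) (i : I) : R :=
  #|A i|%:R * #|S|%:R / N - #|A i :&: S|%:R.

Definition potential (S : {set X}) : R := \sum_i expR (lam * deficit S i).

Hypotheses (m_gt0 : (0 < m)%N) (eta_gt0 : 0 < eta) (th_gt0 : 0 < th) (lam_gt0 : 0 < lam).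
Hypotheses (X_gt0 : (0 < #|X|)%N) (I_gt0 : (0 < #|I|)%N).
Hypothesis lam_m : lam * m%:R <= 1 / 2.
Hypothesis de_ge0 : 0 <= de.

Let N0 : 0 < N. Proof. by rewrite ltr0n. Qed.

(** The three errors of one step: the second-order term of the exponential, the excess [de] of the
    chosen tile, and the contribution of sets with negative deficit. *)
Definition growth : R := 2 * (lam * m%:R) ^+ 2 + lam * m%:R * de + m%:R / (eta * N).

Lemma potential_gt0 S : 0 < potential S.
Proof.
have /card_gt0P[i0 _] := I_gt0; rewrite /potential (bigD1 i0) //=.
by rewrite ltr_pwDl ?expR_gt0 // sumr_ge0 // => i _; rewrite expR_ge0.
Qed.

Definition weight (S : {set X}) (u : X) : R :=
  \sum_i (u \in A i)%:R * expR (lam * deficit S i).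

Lemma weight_bound S u : 0 <= weight S u / potential S <= 1.
Proof.
have p0 := potential_gt0 S.
apply/andP; split.
  by rewrite divr_ge0 ?(ltW p0) // sumr_ge0 // => i _; rewrite mulr_ge0 ?expR_ge0.
rewrite ler_pdivrMr // mul1r; apply: ler_sum => i _.
by case: (_ \in _); rewrite ?mul1r ?mul0r ?expR_ge0.
Qed.

Lemma sum_weight S (B : {set X}) :
  \sum_(u in B) weight S u = \sum_i #|A i :&: B|%:R * expR (lam * deficit S i).
Proof.
rewrite exchange_big /=; apply: eq_bigr => i _; rewrite -mulr_suml; congr (_ * _).
rewrite -sum1_card natr_sum [LHS](bigID (fun u => u \in A i)) /= [X in _ + X]big1 ?addr0.
  under [RHS]eq_bigl do rewrite inE andbC.
  by apply: eq_bigr => u /andP[_ ->].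
by move=> u /andP[_ /negPf ->].
Qed.

(** Removing [B] changes each deficit by [D i], with [lam * D i] at most [1 / 2] in absolute value,
    so the exponential is expanded to second order. The first-order term is controlled by the weight
    of [B]. Adding [#|I|] to the potential turns the additive error into a multiplicative one. *)
Lemma potential_step (S B : {set X}) : B \subset S -> #|B| = m -> eta * N <= #|S|%:R ->
  \sum_(u in B) weight S u / potential S <=
     m%:R * ((\sum_(u in S) weight S u / potential S) / #|S|%:R + de) ->
  potential (S :\: B) + #|I|%:R <= (potential S + #|I|%:R) * (1 + growth).
Proof.
move=> BS cB etaS; have p0 := potential_gt0 S.
have S0 : 0 < #|S|%:R :> R by apply: lt_le_trans etaS; rewrite mulr_gt0.
rewrite -!mulr_suml !sum_weight => hB.
pose E i := expR (lam * deficit S i).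
pose D i : R := #|A i :&: B|%:R - m%:R * #|A i|%:R / N.
have deficitE i : deficit (S :\: B) i = deficit S i + D i.
  have cS : #|S :\: B|%:R = #|S|%:R - m%:R :> R.
    have := cardsID B S; rewrite (setIidPr BS) cB => <-; rewrite natrD; ring.
  have cA : #|A i :&: (S :\: B)|%:R = #|A i :&: S|%:R - #|A i :&: B|%:R :> R.
    have := cardsID B (A i :&: S); rewrite -setIA (setIidPr BS) setIDA => <-.
    by rewrite natrD; ring.
  by rewrite /deficit /D cS cA; ring.
have Dm i : `|lam * D i| <= lam * m%:R.
  rewrite normrM gtr0_norm // ler_wpM2l ?(ltW lam_gt0) // ler_norml.
  have h1 : #|A i :&: B|%:R <= m%:R :> R.
    by rewrite ler_nat -cB subset_leq_card // subsetIr.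
  have h2 : 0 <= m%:R * #|A i|%:R / N by rewrite divr_ge0 // mulr_ge0.
  have h3 : m%:R * #|A i|%:R / N <= m%:R.
    by rewrite ler_pdivrMr // ler_wpM2l // ler_nat max_card.
  have h4 : 0 <= #|A i :&: B|%:R :> R by [].
  by apply/andP; split; rewrite /D; lra.
have step i : expR (lam * deficit (S :\: B) i) <=
    E i * (1 + 2 * (lam * m%:R) ^+ 2) + lam * (E i * D i).
  rewrite deficitE mulrDr expRD -/(E i).
  have h := expR_le_quadratic (le_trans (Dm i) lam_m).
  have sq : (lam * D i) ^+ 2 <= (lam * m%:R) ^+ 2.
    by rewrite -[leLHS]real_normK ?num_real // lerXn2r // nnegrE // mulr_ge0 // ltW.
  apply: (@le_trans _ _ (E i * (1 + lam * D i + 2 * (lam * m%:R) ^+ 2))); last by rewrite le_eqVlt; apply/orP; left; apply/eqP; ring.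
  rewrite ler_wpM2l ?expR_ge0 //; lra.
have sumED : lam * \sum_i E i * D i <=
    lam * m%:R * de * potential S + m%:R / (eta * N) * #|I|%:R.
  have ED : \sum_i E i * D i = \sum_i #|A i :&: B|%:R * E i
      - m%:R * \sum_i (#|A i|%:R / N) * E i.
    by rewrite mulr_sumr -sumrB; apply: eq_bigr => i _; rewrite /D; ring.
  have hB2 : \sum_i #|A i :&: B|%:R * E i <=
      m%:R * ((\sum_i #|A i :&: S|%:R * E i) / #|S|%:R + de * potential S).
    move: hB; rewrite ler_pdivrMr // => /le_trans; apply.
    by rewrite le_eqVlt; apply/orP; left; apply/eqP; field; rewrite !gt_eqF.
  (* The weights favour sets that are under-represented in [S], so the average weight over [S]
     hardly exceeds that over [X]. Sets with negative deficit are the exception; [expR_mulN_le1]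
     bounds the loss by 1 for each set. *)
  have ES : lam * ((\sum_i #|A i :&: S|%:R * E i) / #|S|%:R) <=
      lam * (\sum_i (#|A i|%:R / N) * E i) + #|I|%:R / #|S|%:R.
    rewrite -(ler_pM2r S0).
    have -> : lam * ((\sum_i #|A i :&: S|%:R * E i) / #|S|%:R) * #|S|%:R =
        \sum_i lam * (#|A i :&: S|%:R * E i).
      by rewrite mulrA divfK ?gt_eqF // mulr_sumr.
    have -> : (lam * (\sum_i (#|A i|%:R / N) * E i) + #|I|%:R / #|S|%:R) * #|S|%:R =
        \sum_i (lam * (#|A i|%:R / N * E i) * #|S|%:R + 1).
      rewrite big_split /= sumr_const mulrDl divfK ?gt_eqF //.
      by rewrite -mulr_suml -mulr_sumr.
    apply: ler_sum => i _; have := expR_mulN_le1 (lam * deficit S i).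
    rewrite -/(E i) /deficit.
    set a := #|A i|%:R / N; rewrite (_ : _ * _ / N = a * #|S|%:R); last by rewrite /a; ring.
    lra.
  have IS : #|I|%:R / #|S|%:R <= #|I|%:R / (eta * N).
    by rewrite ler_wpM2l // lef_pV2 // posrE mulr_gt0.
  have := ler_wpM2l (ltW lam_gt0) hB2.
  have := ler_wpM2l (ler0n R m) (le_trans ES (lerD (lexx _) IS)).
  rewrite ED; set a1 := \sum_i _; set a2 := \sum_i _; set a3 := \sum_i _ * E i.
  lra.
have total : potential (S :\: B) <= potential S * (1 + 2 * (lam * m%:R) ^+ 2)
    + (lam * m%:R * de * potential S + m%:R / (eta * N) * #|I|%:R).
  apply: le_trans (ler_sum _ (fun i _ => step i)) _.
  by rewrite big_split /= -mulr_suml -mulr_sumr lerD2l.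
have n1 : 0 <= m%:R / (eta * N) * potential S.
  by rewrite mulr_ge0 ?(ltW p0) // divr_ge0 // mulr_ge0 // ltW.
have n2 : 0 <= lam * m%:R * de * #|I|%:R.
  by rewrite !mulr_ge0 // ltW.
have n3 : 0 <= 2 * (lam * m%:R) ^+ 2 * #|I|%:R by rewrite mulr_ge0 // mulr_ge0 // sqr_ge0.
apply: le_trans (_ : _ <= potential S * (1 + 2 * (lam * m%:R) ^+ 2)
    + (lam * m%:R * de * potential S + m%:R / (eta * N) * #|I|%:R) + #|I|%:R) _.
  by rewrite lerD2r.
rewrite /growth; lra.
Qed.

Hypothesis find_tile : forall S : {set X}, eta * N <= #|S|%:R ->
  (forall i, #|S :\: A i|%:R <= #|S|%:R * (#|~: A i|%:R / N + th)) ->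
  forall y : X -> R, (forall v, 0 <= y v <= 1) ->
  exists B : {set X}, [/\ B \subset S, P B, #|B| = m &
     \sum_(u in B) y u <= m%:R * ((\sum_(u in S) y u) / #|S|%:R + de)].

Hypothesis I_small : #|I|%:R <= 2 * N.
Hypothesis lam_small : 2 * lam * m%:R <= th * eta / 4.
Hypothesis de_small : de <= th * eta / 4.
Hypothesis N_large : 8 * expR (eta^-1) < (lam * th * eta / 2) ^+ 2 * N.

Lemma deficit_small (S : {set X}) (t : nat) i : (t * m <= n)%N -> eta * N <= #|S|%:R ->
  potential S + #|I|%:R <= 2 * #|I|%:R * expR (t%:R * growth) ->
  #|S :\: A i|%:R <= #|S|%:R * (#|~: A i|%:R / N + th).
Proof.
move=> tm etaS pot.
suff dS : deficit S i <= th * eta * N.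
  have c1 : #|S :\: A i|%:R = #|S|%:R - #|A i :&: S|%:R :> R.
    by rewrite setIC -(cardsID (A i) S) natrD; ring.
  have c2 : #|~: A i|%:R = N - #|A i|%:R :> R.
    by rewrite -(cardsC (A i)) natrD; ring.
  have : th * (eta * N) <= th * #|S|%:R by rewrite ler_wpM2l // ltW.
  rewrite c1 c2 mulrBl divff ?gt_eqF //; move: dS; rewrite /deficit; lra.
rewrite leNgt; apply/negP => dS.
(* [c] is half the exponential rate reached by a deficit of [th * eta * N]. The accumulated growth
   uses up only this half, and the other half would give [expR (c * N) <= 4 * N * expR (eta^-1)],
   against the quadratic lower bound for [expR]. *)
pose c := lam * th * eta / 2.
have cN : 8 * expR (eta^-1) < c ^+ 2 * N by exact: N_large.
have c0 : 0 < c by rewrite divr_gt0 // !mulr_gt0.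
have tN : t%:R * m%:R <= N by rewrite -natrM ler_nat.
have gr : t%:R * growth <= c * N + eta^-1.
  have -> : t%:R * growth = (t%:R * m%:R) * (lam * (2 * lam * m%:R + de) + (eta * N)^-1).
    by rewrite /growth; ring.
  apply: (@le_trans _ _ (N * (lam * (2 * lam * m%:R + de) + (eta * N)^-1))).
    rewrite ler_wpM2r // addr_ge0 ?invr_ge0 ?mulr_ge0 ?addr_ge0 ?mulr_ge0 //; exact: ltW.
  have eE : N * (eta * N)^-1 = eta^-1 by field; rewrite !gt_eqF.
  rewrite mulrDr eE lerD2r [leLHS]mulrC ler_wpM2r //.
  rewrite /c -!mulrA ler_wpM2l ?(ltW lam_gt0) //; move: lam_small de_small; lra.
have h1 : expR (lam * (th * eta * N)) <= 2 * #|I|%:R * expR (c * N + eta^-1).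
  apply: (@le_trans _ _ (potential S + #|I|%:R)).
    apply: (@le_trans _ _ (expR (lam * deficit S i))).
      by rewrite ler_expR ler_wpM2l // ltW.
    rewrite /potential (bigD1 i) //= -addrA lerDl addr_ge0 // sumr_ge0 // => j _.
    exact: expR_ge0.
  apply: le_trans pot _; rewrite ler_wpM2l ?mulr_ge0 //.
  by rewrite ler_expR.
have h2 : expR (c * N) <= 4 * N * expR (eta^-1).
  rewrite -(ler_pM2r (expR_gt0 (c * N))) -expRD.
  have -> : c * N + c * N = lam * (th * eta * N) by rewrite /c; lra.
  apply: le_trans h1 _; rewrite expRD.
  have := ler_wpM2r (mulr_ge0 (expR_ge0 (c * N)) (expR_ge0 (eta^-1))) I_small.
  lra.
have h3 : (c * N) ^+ 2 / 2 <= expR (c * N).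
  have := @expR_ge1Dxn R (c * N) 1 (mulr_ge0 (ltW c0) (ltW N0)).
  rewrite (_ : 2`!%:R = 2 :> R) //; lra.
have h4 : N * (c ^+ 2 * N) <= N * (8 * expR (eta^-1)).
  have := le_trans h3 h2; rewrite exprMn; lra.
by move: h4; rewrite ler_pM2l // leNgt cN.
Qed.

Lemma greedy_tiling : exists F : {set {set X}},
  [/\ trivIset F, forall B, B \in F -> P B /\ #|B| = m
    & (1 - eta) * N <= #|cover F|%:R].
Proof.
pose tiling (F : {set {set X}}) :=
  [/\ trivIset F, set0 \notin F & forall B, B \in F -> P B /\ #|B| = m].
(* Either fewer than [eta * N] vertices remain at some stage, or [t] tiles have been removed with
   the potential under control. The second case is impossible for [t = n.+1]. *)
have main t : (exists2 F, tiling F & (1 - eta) * N <= #|cover F|%:R) \/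
  exists F, [/\ tiling F, #|cover F| = (t * m)%N &
    potential (~: cover F) + #|I|%:R <= 2 * #|I|%:R * expR (t%:R * growth)].
  elim: t => [|t [] ]; [right | by left |].
    exists set0; split.
    - split; [|by rewrite inE|by move=> B; rewrite inE].
      by apply/trivIsetP => ? ?; rewrite inE.
    - by rewrite /cover big_set0 cards0.
    - rewrite /cover big_set0 setC0 mul0r expR0 mulr1 mulr2n mulrDl mul1r lerD2r.
      rewrite /potential -[leRHS]sumr_const; apply: ler_sum => i _.
      rewrite (_ : deficit _ _ = 0) ?mulr0 ?expR0 // /deficit setIT cardsT mulfK ?gt_eqF //.
      by rewrite subrr.
  move=> [F [tF cF pF]].
  have [h|h] := leP (eta * N) #|~: cover F|%:R; last first.
    left; exists F => //; have : #|cover F|%:R + #|~: cover F|%:R = N.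
      by rewrite -natrD cardsC.
    by move: h; lra.
  right.
  have tm : (t * m <= n)%N by rewrite -cF max_card.
  have [B [BS PB cB hB]] := find_tile h (fun i => deficit_small i tm h pF)
    (fun u => weight_bound (~: cover F) u).
  have [tF1 tF2 tF3] := tF.
  have B0 : B != set0 by rewrite -card_gt0 cB.
  have [|tr _] := @trivIsetU1 _ B F _ tF1 tF2.
    move=> C CF; rewrite disjoint_sym disjoints_subset.
    apply: subset_trans (_ : cover F \subset _); first exact: bigcup_sup.
    by rewrite -setCS setCK.
  have covE : cover (B |: F) = B :|: cover F by rewrite /cover bigcup_setU big_set1.
  exists (B |: F); split.
  - split=> //; first by rewrite !inE eq_sym (negPf B0).
    by move=> C; rewrite !inE => /orP[/eqP->|/tF3].
  - rewrite covE cardsU cB cF (_ : B :&: _ = set0) ?cards0 ?subn0 ?mulSn //.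
    by apply/eqP; rewrite setI_eq0 disjoints_subset.
  - rewrite covE setCU setIC -setDE.
    apply: le_trans (potential_step BS cB h hB) _.
    rewrite -[t.+1%:R]natr1 [(_ + 1) * growth]mulrDl mul1r expRD [leRHS]mulrA.
    apply: ler_pM => //; last exact: expR_ge1Dx.
      by rewrite addr_ge0 // ltW // potential_gt0.
    rewrite /growth !addr_ge0 ?mulr_ge0 ?sqr_ge0 ?invr_ge0 ?mulr_ge0 //; exact: ltW.
have [[F [tF _ PF] cF]|[F [_ cF _]]] := main n.+1; first by exists F.
have : (n.+1 * m <= n)%N by rewrite -cF max_card.
by rewrite leqNgt (leq_trans (leqnn n.+1)) // leq_pmulr.
Qed.

End GreedyTiling.

Lemma is_bottle_val (X : finType) (e : rel X) (S : {set X}) (s a b : nat)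
    (B : {set {v | v \in S}}) :
  is_bottle (fun u v : {v | v \in S} => e (val u) (val v)) s a b B ->
  is_bottle e s a b (val @: B).
Proof.
move=> [T [cT eT ->]]; exists (fun i => val @: T i); split.
- by move=> i; rewrite card_imset //; exact: val_inj.
- by move=> i j _ _ ij /imsetP[u uT ->] /imsetP[v vT ->]; exact: eT ij uT vT.
- apply/setP => u; apply/imsetP/bigcupP => [[v /bigcupP[i _ vT] ->]|[i _ /imsetP[v vT ->]]].
    by exists i => //; apply: imset_f.
  by exists v => //; apply/bigcupP; exists i.
Qed.

Theorem bottle_tiling (R : realType) (s a b : nat) (ga eta : R) :
  let m := (a + s * b)%N in
  let al := a%:R / m%:R in let be := b%:R / m%:R in
  (0 < s)%N -> (0 < a < b)%N -> 0 < ga -> ga <= 1 -> 0 < eta ->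
  exists L n0 : nat, (0 < L)%N /\
  forall (X : finType) (e : rel X) (cls : X -> 'I_L),
  symmetric e -> irreflexive e -> (n0 <= #|X|)%N ->
  (forall k : 'I_L, \sum_u (cls u <= k)%N%:R <= (k.+2)%:R / L%:R * (#|X|%:R : R)) ->
  (forall v, \sum_u (~~ e v u)%:R <=
     (be + al * Num.max 0 (1 - (cls v)%:R / L%:R / be) - ga) * #|X|%:R) ->
  exists F : {set {set X}},
  [/\ trivIset F, forall B, B \in F -> is_bottle e s a b B /\ #|B| = m
    & (1 - eta) * #|X|%:R <= #|cover F|%:R].
Proof.
move=> m al be s0 ab ga0 ga1 eta0.
have m0 : (0 < m)%N by case/andP: ab => a0 _; rewrite /m addn_gt0 a0.
have m0' : 0 < m%:R :> R by rewrite ltr0n.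
(* The remainder may lose [th] in every density. With [2 / L <= th] for rounding, ranks stay within
   [ga / 4] and the degree slack stays above [ga / 2]. *)
pose th := ga / 8; have th0 : 0 < th by rewrite divr_gt0.
have te0 : 0 < th * eta by rewrite mulr_gt0.
pose de := Num.min 1 (th * eta / 4).
have de0 : 0 < de by rewrite lt_min ltr01 divr_gt0.
have de1 : de <= 1 by rewrite /de ge_min lexx.
have de2 : de <= th * eta / 4 by rewrite /de ge_min lexx orbT.
pose lam := Num.min (1 / 2) (th * eta / 8) / m%:R.
have lm : lam * m%:R = Num.min (1 / 2) (th * eta / 8) by rewrite divfK // gt_eqF.
have lam0 : 0 < lam by rewrite divr_gt0 // lt_min !divr_gt0.
have lam1 : lam * m%:R <= 1 / 2 by rewrite lm ge_min lexx.
have lam2 : 2 * lam * m%:R <= th * eta / 4.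
  have : lam * m%:R <= th * eta / 8 by rewrite lm ge_min lexx orbT.
  lra.
have [L1 hL1] := nat_upper_bound (2 / th).
pose L := L1.+1.
have hL : 2 / L%:R <= th.
  rewrite ler_pdivrMr ?ltr0n // -ler_pdivrMl // mulrC; apply: le_trans hL1 _.
  by rewrite ler_nat leqnSn.
have xi0 : 0 <= ga / 4 by rewrite divr_ge0 // ltW.
have xiga : ga / 4 < ga / 2 by lra.
have ga2 : ga / 2 <= 1 by lra.
have [n1 find] := @cheap_bottle R s L a b (ga / 2) (ga / 4) de s0 ab xi0 xiga ga2 de0 de1.
have [n2 hn2] := nat_upper_bound (n1%:R / eta).
pose c := lam * th * eta / 2.
have c0 : 0 < c by apply: divr_gt0 => //; apply: mulr_gt0 => //; apply: mulr_gt0.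
have [n3 hn3] := nat_upper_bound (8 * sequences.expR (eta^-1) / c ^+ 2).
exists L, (L + n2 + n3.+1)%N; split=> // X e cls e_sym e_irr nX rank miss.
have hN k : (k <= L + n2 + n3.+1)%N -> k%:R <= #|X|%:R :> R.
  by move=> h; rewrite ler_nat (leq_trans h).
have X0 : (0 < #|X|)%N by apply: leq_trans nX; rewrite addnS.
have N0 : 0 < #|X|%:R :> R by rewrite ltr0n.
(* The complements of the initial segments are tracked: a small deficit bounds [S :\: A i] from
   above, and it is the segment that must not become too dense. *)
pose A (i : X + 'I_L) : {set X} := match i with
  inl v => [set u | e v u] | inr k => [set u | ~~ (cls u <= k)%N] end.
have cI : #|{: X + 'I_L}|%:R <= 2 * #|X|%:R :> R.
  rewrite card_sum card_ord natrD mulr2n mulrDl mul1r lerD2l; apply: hN.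
  by rewrite -addnA leq_addr.
have I0 : (0 < #|{: X + 'I_L}|)%N by rewrite card_sum addn_gt0 X0.
apply: (@greedy_tiling R X _ A (is_bottle e s a b) m eta th de lam) => //.
- exact: ltW.
- move=> S etaS good y y01.
  pose Y := {v | v \in S}.
  have cY : #|{: Y}| = #|S| by rewrite card_sig; apply: eq_card => v; rewrite inE.
  have S0 : 0 < #|S|%:R :> R by apply: lt_le_trans etaS; rewrite mulr_gt0.
  have sumY (f : X -> R) : \sum_(v : Y) f (val v) = \sum_(v in S) f v.
    by rewrite -(big_sub (mem S)).
  have sumC (p : pred X) : \sum_(v in S) (p v)%:R = #|S :\: [set u | ~~ p u]|%:R :> R.
    rewrite -sum1_card natr_sum [LHS](bigID p) /= [X in _ + X]big1 ?addr0.
      under [RHS]eq_bigl do rewrite !inE negbK andbC.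
      by apply: eq_bigr => v /andP[_ ->].
    by move=> v /andP[_ /negPf ->].
  have [||||||B [bB cB hB]] := find Y (fun u v => e (val u) (val v))
      (fun u => cls (val u)) (fun u => y (val u)).
  + by move=> u v; exact: e_sym.
  + by move=> u; exact: e_irr.
  + rewrite cY -(ler_nat R); apply: le_trans etaS; rewrite mulrC -ler_pdivrMr //.
    by apply: le_trans hn2 (hN _ _); rewrite addnAC leq_addl.
  + by move=> v; exact: y01.
  + move=> k; rewrite (sumY (fun u => (cls u <= k)%N%:R)) (sumC (fun u => (cls u <= k)%N)) cY.
    have := good (inr k); rewrite /= => /le_trans; apply.
    rewrite mulrC ler_wpM2r ?(ltW S0) //.
    have -> : #|~: [set u | ~~ (cls u <= k)%N]|%:R = \sum_u (cls u <= k)%N%:R :> R.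
      by rewrite -natr_card; congr _%:R; apply: eq_card => u; rewrite !inE negbK.
    have h : (\sum_u (cls u <= k)%N%:R) / #|X|%:R <= k.+2%:R / L%:R :> R.
      by rewrite ler_pdivrMr // rank.
    have h' : k.+2%:R / L%:R = k%:R / L%:R + 2 / L%:R :> R by rewrite -mulrDl -natrD addn2.
    by move: h; rewrite h'; move: hL; rewrite /th; lra.
  + move=> v; rewrite (sumY (fun u => (~~ e (val v) u)%:R)) sumC cY.
    have := good (inl (val v)); rewrite /= => h.
    have -> : #|S :\: [set u | ~~ ~~ e (val v) u]|%:R = #|S :\: [set u | e (val v) u]|%:R :> R.
      by congr _%:R; apply: eq_card => u; rewrite !inE negbK.
    apply: (le_trans h); rewrite mulrC ler_wpM2r ?(ltW S0) //.
    have -> : #|~: [set u | e (val v) u]|%:R = \sum_u (~~ e (val v) u)%:R :> R.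
      by rewrite -natr_card; congr _%:R; apply: eq_card => u; rewrite !inE.
    have h2 := miss (val v); rewrite -ler_pdivrMr // in h2.
    by move: h2; rewrite -/al -/be /th; lra.
  exists (val @: B); split.
  + by apply/subsetP => _ /imsetP[v _ ->]; exact: valP.
  + exact: is_bottle_val.
  + by rewrite card_imset //; exact: val_inj.
  + rewrite big_imset /= => [|? ? _ _ /val_inj //].
    by move: hB; rewrite cY (sumY y).
- have h : 8 * sequences.expR (eta^-1) / c ^+ 2 < #|X|%:R.
    apply: le_lt_trans hn3 _; rewrite ltr_nat; apply: leq_trans nX.
    by rewrite leq_addl.
  by rewrite ltr_pdivrMr ?exprn_gt0 // [ltRHS]mulrC in h.
Qed.

(** * Choice of parameters *)

(** Raising [be] only increases the maximum, and lowering [al] by at most [d] costs at most [d], as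
    the maximum is at most 1. *)
Lemma le_max_slope (R : realFieldType) (al be al' be' d rho : R) :
  0 <= al' -> al' <= al -> al <= al' + d -> 0 < be -> be <= be' -> 0 <= rho -> 0 <= d ->
  be + al * Num.max 0 (1 - rho / be) <= be' + al' * Num.max 0 (1 - rho / be') + d.
Proof.
move=> al'0 al'al ald be0 bebe' rho0 d0.
set M := Num.max 0 (1 - rho / be); set M' := Num.max 0 (1 - rho / be').
have M0 : 0 <= M by rewrite /M le_max lexx.
have M1 : M <= 1 by rewrite /M ge_max ler01 gerBl divr_ge0 // ltW.
have MM' : M <= M'.
  rewrite /M /M' ge_max !le_max lexx /=; apply/orP; right.
  rewrite lerB // ler_wpM2l // lef_pV2 ?posrE //; exact: lt_le_trans bebe'.
have h1 := ler_wpM2r M0 ald.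
have h2 := ler_wpM2l al'0 MM'.
have h3 := ler_wpM2l d0 M1.
lra.
Qed.

Lemma floor_nat (R : realType) (x : R) : 0 <= x -> exists n : nat, n%:R <= x < n%:R + 1.
Proof.
move=> x0; exists (Num.truncn x).
by have := truncn_itv x0; rewrite -natr1.
Qed.

Lemma bottle_parameters (R : realType) (x : R) (s K sg h : nat) :
  0 < x < 1 -> (0 < s)%N -> (0 < K)%N -> (0 < sg)%N -> (s.+1 * sg <= h)%N ->
  let al : R := x * sg%:R / h%:R in let be := (1 - al) / s%:R in
  exists b : nat, let a := (s * K * sg)%N in let m := (a + s * b)%N in
  [/\ (0 < a < b)%N, (K * (h - sg) <= b)%N,
      a%:R / m%:R <= al <= a%:R / m%:R + K%:R^-1, be <= b%:R / m%:R
    & x - K%:R^-1 <= (s * K * h)%:R / m%:R <= x].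
Proof.
move=> /andP[x0 x1] s0 K0 sg0 sgh al be.
have sR : 1 <= s%:R :> R by rewrite ler1n.
have KR : 0 < K%:R :> R by rewrite ltr0n.
have sgR : 1 <= sg%:R :> R by rewrite ler1n.
have sghR : (s%:R + 1) * sg%:R <= h%:R :> R by rewrite natr1 -natrM ler_nat.
have hR : 1 <= h%:R :> R.
  have : 1 * 1 <= s%:R * sg%:R :> R by apply: ler_pM.
  by move: sghR sgR; clear; lra.
have sg_h : (sg <= h)%N by apply: leq_trans sgh; rewrite leq_pmull.
have xsg : x * sg%:R <= sg%:R by rewrite ler_piMl //; exact: ltW.
have sgh' : sg%:R <= h%:R :> R by rewrite ler_nat.
have w0 : 0 <= K%:R * (h%:R - x * sg%:R) / x.
  rewrite divr_ge0 ?mulr_ge0 //; [by rewrite subr_ge0 (le_trans xsg)|exact: ltW].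
(* This real number is the exact solution for [b] in [a : b = al : be]. Rounding up enlarges the
   bottle slightly, so both [a / m] and the tiled proportion only decrease, by at most [K^-1]. *)
have [b0 /andP[hb1 hb2]] := floor_nat w0.
exists b0.+1; move=> a m.
set w := K%:R * (h%:R - x * sg%:R) / x in w0 hb1 hb2.
have bw : w <= b0.+1%:R by rewrite -natr1 ltW.
have bw1 : b0.+1%:R <= w + 1 by rewrite -natr1 lerD2r.
have wE : x * w = K%:R * (h%:R - x * sg%:R) by rewrite /w mulrC divfK // gt_eqF.
have aE : a%:R = s%:R * K%:R * sg%:R :> R by rewrite /a !natrM.
have mE : m%:R = s%:R * K%:R * sg%:R + s%:R * b0.+1%:R :> R.
  by rewrite /m natrD aE natrM.
have xm1 : s%:R * K%:R * h%:R <= x * m%:R.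
  have : x * (s%:R * w) <= x * (s%:R * b0.+1%:R).
    by rewrite ler_pM2l // ler_pM2l ?(lt_le_trans ltr01).
  rewrite mE mulrDr; have -> : x * (s%:R * w) = s%:R * (K%:R * (h%:R - x * sg%:R)).
    by rewrite -wE; ring.
  lra.
have xm2 : x * m%:R <= s%:R * K%:R * h%:R + x * s%:R.
  have : x * (s%:R * b0.+1%:R) <= x * (s%:R * (w + 1)).
    by rewrite ler_pM2l // ler_pM2l ?(lt_le_trans ltr01).
  rewrite mE [x * (_ + _)]mulrDr.
  have -> : x * (s%:R * (w + 1)) = s%:R * (K%:R * (h%:R - x * sg%:R)) + x * s%:R.
    by rewrite -wE; ring.
  lra.
have h0 : 0 < h%:R :> R by apply: lt_le_trans hR.
have s0R : 0 < s%:R :> R by apply: lt_le_trans sR.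
have m0 : 0 < m%:R :> R.
  by rewrite -(pmulr_rgt0 _ x0); apply: lt_le_trans xm1; rewrite !mulr_gt0.
set q := (s * K * h)%:R / m%:R.
have qE : q * m%:R = s%:R * K%:R * h%:R by rewrite /q divfK ?gt_eqF // !natrM.
have q1 : q <= x by rewrite -(ler_pM2r m0) qE.
have q2 : x - K%:R^-1 <= q.
  rewrite -(ler_pM2r m0) qE mulrBl.
  have xs : x * s%:R <= K%:R^-1 * m%:R.
    rewrite -(ler_pM2l KR) mulrA [leRHS]mulrA divff ?gt_eqF // mul1r.
    rewrite -(ler_pM2l x0); apply: le_trans xm1.
    have e1 : s%:R * K%:R * (x * x) <= s%:R * K%:R * h%:R.
      rewrite ler_pM2l ?mulr_gt0 //; apply: le_trans hR.
      by rewrite mulr_ile1 // ltW.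
    lra.
  lra.
have alE : a%:R / m%:R = sg%:R / h%:R * q.
  by rewrite aE /q !natrM; field; rewrite !gt_eqF.
have alE2 : al = sg%:R / h%:R * x by rewrite /al; ring.
have r0 : 0 <= sg%:R / h%:R :> R by rewrite divr_ge0.
have r1 : sg%:R / h%:R <= 1 :> R by rewrite ler_pdivrMr // mul1r.
have al1 : a%:R / m%:R <= al by rewrite alE alE2 ler_wpM2l.
have al2 : al <= a%:R / m%:R + K%:R^-1.
  rewrite alE alE2.
  have := ler_wpM2l r0 q2; have : sg%:R / h%:R * K%:R^-1 <= 1 * K%:R^-1 :> R.
    by rewrite ler_wpM2r // invr_ge0 ltW.
  lra.
have bE : b0.+1%:R / m%:R = (1 - a%:R / m%:R) / s%:R :> R.
  have -> : 1 - a%:R / m%:R = s%:R * b0.+1%:R / m%:R :> R.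
    have m1 : m%:R != 0 :> R by rewrite gt_eqF.
    by apply: (mulIf m1); rewrite mulrBl mul1r !divfK // mE aE; ring.
  by rewrite mulrAC [s%:R * _]mulrC mulfK // gt_eqF.
have be1 : be <= b0.+1%:R / m%:R.
  by rewrite bE /be ler_pM2r ?invr_gt0 // lerD2l lerN2.
split; rewrite ?al1 ?al2 ?q1 ?q2 //.
- apply/andP; split; first by rewrite /a !muln_gt0 s0 K0.
  rewrite -(ltr_nat R) -(ltr_pM2r (_ : 0 < m%:R^-1)) ?invr_gt0 //.
  apply: le_lt_trans al1 (lt_le_trans _ be1).
  rewrite /be ltr_pdivlMr //.
  have : al * (s%:R + 1) < 1.
    rewrite alE2; apply: (@le_lt_trans _ _ x) => //.
    rewrite -[leRHS]mul1r mulrAC ler_wpM2r ?(ltW x0) // mulrAC ler_pdivrMr // mul1r.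
    by rewrite mulrC.
  lra.
- rewrite -(ler_nat R); apply: le_trans bw; rewrite natrM natrB //.
  rewrite -(ler_pM2l x0) wE mulrCA ler_pM2l //.
  have : x * h%:R <= h%:R by rewrite ler_piMl // ltW.
  lra.
Qed.

(** * From the degree sequence to numbers of non-neighbours *)

Section DegreeSequence.

Variables (R : realType) (G : sgraph) (al be : R).
Local Notation n := (#|G|%:R : R).
Hypotheses (al0 : 0 < al) (alb : al < be) (be1 : be <= 1) (ben : 1 <= be * n).
Hypothesis deg : forall i : nat, (1 <= i)%N -> i%:R <= be * n ->
  (1 - al - be) * n + al / be * i%:R <= (dseq G i)%:R.

Lemma missing_degree (v : G) : \sum_u (~~ edge v u)%:R = n - (degree v)%:R.
Proof.
rewrite -natr_card; apply/eqP; rewrite eq_sym subr_eq -natrD eqr_nat; apply/eqP.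
rewrite addnC /degree -(cardsC [set w | edge v w]); congr (_ + _)%N.
by apply: eq_card => u; rewrite !inE.
Qed.

Lemma missing_position (v : G) (i : nat) (rho : R) :
  (forall i j, (i <= j)%N -> (j < #|G|)%N -> (dseq G i.+1 <= dseq G j.+1)%N) ->
  (i < #|G|)%N -> dseq G i.+1 = degree v -> rho * n <= i%:R ->
  \sum_u (~~ edge v u)%:R <= (be + al * Num.max 0 (1 - rho / be)) * n + 1.
Proof.
move=> mono iG dv rn; rewrite missing_degree -dv.
have be0 : 0 < be by apply: lt_trans alb.
have ab1 : al / be <= 1 by rewrite ler_pdivrMr // mul1r ltW.
have ab0 : 0 < al / be by rewrite divr_gt0.
have n0 : 0 < n by rewrite ltr0n (leq_trans _ iG).
set M := Num.max _ _.
have M0 : 0 <= M by rewrite /M le_max lexx.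
have M1 : 1 - rho / be <= M by rewrite /M le_max lexx orbT.
have [ib|ib] := leP (i.+1%:R : R) (be * n).
  have := deg (ltn0Sn i) ib.
  have h1 : al * n * (1 - rho / be) <= al * n * M by rewrite ler_pM2l // mulr_gt0.
  have h2 : al / be * (rho * n) <= al / be * i.+1%:R.
    by rewrite ler_pM2l // (le_trans rn) // ler_nat.
  have h3 : al * n * (1 - rho / be) = al * n - al / be * (rho * n) by ring.
  lra.
(* Beyond rank [be * n] the hypothesis is applied at [j], the integer part of [be * n], and carried
   over by monotonicity. The rounding accounts for the final [+ 1]. *)
have [j /andP[hj1 hj2]] := floor_nat (le_trans ler01 ben).
have j0 : (0 < j)%N.
  by rewrite lt0n; apply/eqP => j0; move: hj2; rewrite j0 add0r; move: ben; lra.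
have ji : (j.-1 <= i)%N.
  rewrite -ltnS prednK //; apply: ltnW; rewrite -(ltr_nat R).
  exact: le_lt_trans ib.
have := mono _ _ ji iG; rewrite prednK // -(ler_nat R).
have := deg j0 hj1.
have h1 : 0 <= al * M * n by rewrite !mulr_ge0 // ltW.
have h2 : al / be * (be * n) <= al / be * (j%:R + 1) by rewrite ler_pM2l // ltW.
have h3 : al / be * (be * n) = al * n by field; rewrite gt_eqF.
lra.
Qed.

End DegreeSequence.

Lemma count_positions (R : realType) (X : finType) (pos : X -> nat) (L k : nat) :
  injective pos -> (forall v, pos v < #|X|)%N -> (0 < L)%N ->
  \sum_v (pos v * L %/ #|X| <= k)%N%:R <= k.+1%:R / L%:R * #|X|%:R + 1 :> R.
Proof.
move=> pos_inj pos_lt L0; rewrite -natr_card.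
set c := (k.+1 * #|X| %/ L)%N.
have : (#|[set v | (pos v * L %/ #|X| <= k)%N]| <= c.+1)%N.
  rewrite -[X in (_ <= X)%N]card_ord -(@card_in_imset _ _ (fun v => inord (pos v) : 'I_c.+1)).
    exact: max_card.
  have small v : v \in [set v | (pos v * L %/ #|X| <= k)%N] -> (pos v < c.+1)%N.
    have X0 : (0 < #|X|)%N by apply: leq_trans (pos_lt v).
    rewrite inE -ltnS ltn_divLR // => h; rewrite ltnS /c leq_divRL //; exact: ltnW.
  move=> u v uS vS /(congr1 val) /=; rewrite !inordK ?small //; exact: pos_inj.
rewrite -(ler_nat R) => /le_trans; apply.
rewrite -natr1 lerD2r mulrAC ler_pdivlMr ?ltr0n // -!natrM ler_nat.
exact: leq_trunc_div.
Qed.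

(** * Assembly of the proof *)

Theorem theorem1p5 (R : realType) (x : R) (H : sgraph) (r : nat) (eta : R)
    (hx : 0 < x < 1)
    (hH : exists u v : H, edge u v)
    (hr : chi H = r)
    (heta : 0 < eta) :
  let s : R := (sigma H)%:R in
  let h : R := #|H|%:R in
  exists n0 : nat, forall (n : nat) (G : sgraph),
    (n0 <= n)%N -> #|G| = n ->
    (forall i : nat, (1 <= i)%N ->
       i%:R <= (h - x * s) / ((r%:R - 1) * h) * n%:R ->
       (gH H x - x * s / h) * n%:R
         + (r%:R - 1) * x * s / (h - x * s) * i%:R <= (dseq G i)%:R) ->
    exists T : {set {ffun H -> G}},
      is_tiling T /\ (x - eta) * n%:R <= #|covered T|%:R.
Proof.
move=> sg h.
have [s rE] : exists s, r = s.+2.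
  by have := chi_gt1 hH; rewrite hr; case: (r) => [|[|s]] // _; exists s.
rewrite {r}rE in hr *.
have sg0 := sigma_gt0 hH; have sgh := sigma_chi_le hH; rewrite hr in sgh.
pose S := s.+1.
have S0 : (0 < S)%N by [].
have S1 : 1 <= S%:R :> R by rewrite ler1n.
have /andP[x0 x1] := hx.
have sgR : 1 <= sg by rewrite ler1n.
have sghR : (S%:R + 1) * sg <= h by rewrite natr1 -natrM ler_nat.
have hR : 1 <= h.
  have : 1 * 1 <= S%:R * sg by apply: ler_pM.
  by move: sghR sgR; clear; lra.
have h0 : 0 < h by apply: lt_le_trans hR.
pose al := x * sg / h; pose be := (1 - al) / S%:R.
have al0 : 0 < al by rewrite divr_gt0 // mulr_gt0 // (lt_le_trans ltr01).
have alS : al * (S%:R + 1) < 1.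
  rewrite /al mulrAC ltr_pdivrMr // mul1r.
  have : x * ((S%:R + 1) * sg) <= x * h by rewrite ler_pM2l.
  have : x * h < 1 * h by rewrite ltr_pM2r.
  clear; lra.
have SR0 : 0 < S%:R :> R by apply: lt_le_trans S1.
have alb : al < be by rewrite /be ltr_pdivlMr //; move: alS; clear; lra.
have be0 : 0 < be by apply: lt_trans alb.
have be1 : be <= 1.
  by rewrite /be ler_pdivrMr // mul1r; move: al0 S1; clear; lra.
pose eta1 := Num.min eta 1.
have eta10 : 0 < eta1 by rewrite lt_min heta ltr01.
have eta11 : eta1 <= 1 by rewrite /eta1 ge_min lexx orbT.
have eta1e : eta1 <= eta by rewrite /eta1 ge_min lexx.
(* About [eps * n] universal vertices are added; the copies meeting them cover at most
   [eta1 / 4 * n] vertices, rounding included. *)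
pose eps := eta1 / (8 * h).
have eps0 : 0 < eps by apply: divr_gt0 => //; apply: mulr_gt0.
have epsh : eps * h = eta1 / 8 by rewrite /eps; field; rewrite gt_eqF.
have eps1 : eps <= eta1 / 8 by rewrite -epsh ler_peMr // ltW.
(* The universal vertices improve the degree condition by [be * eps * n = 8 * ga * n]. Of this, 2
   units pay for replacing [al], [be] by the bottle proportions, 3 for the slack [ga] on [G'], and 1
   for rounding. *)
pose ga := be * eps / 8.
have ga0 : 0 < ga by apply: divr_gt0 => //; apply: mulr_gt0.
have beps : be * eps <= eps by rewrite ler_piMl // ltW.
have gab : ga <= be / 8.
  have : be * eps <= be * 1 by rewrite ler_pM2l //; move: eps1 eta11; clear; lra.
  rewrite /ga; clear; lra.
have ga1 : ga <= 1 by move: gab be1; clear; lra.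
have [K0 hK0] := nat_upper_bound ((2 * ga)^-1).
pose K := K0.+1.
have KR : 0 < K%:R :> R by rewrite ltr0n.
have Kga : K%:R^-1 <= 2 * ga.
  have ga20 : 0 < (2 * ga)^-1 by rewrite invr_gt0; apply: mulr_gt0.
  rewrite -[leRHS]invrK lef_pV2 ?posrE //.
  by apply: (le_trans hK0); rewrite ler_nat.
have [b [ab Kb /andP[al'1 al'2] be'1 /andP[q1 q2]]] :=
  bottle_parameters hx S0 (ltn0Sn K0) sg0 sgh.
set a := (S * K * sigma H)%N in ab al'1 al'2 be'1 q1 q2.
have [|L [n1 [L0 tiling]]] := @bottle_tiling R S a b ga (eta1 / 4) S0 ab ga0 ga1.
  by rewrite divr_gt0.
set m := (a + S * b)%N in al'1 al'2 be'1 q1 q2 tiling.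
case: L L0 tiling => [//|L] _ tiling.
have [n2 hn2] := nat_upper_bound (8 / (be * eps)).
exists (n1 + n2 + L.+1)%N => n G n0n Gn deg.
have nR k : (k <= n1 + n2 + L.+1)%N -> k%:R <= n%:R :> R.
  by move=> hk; rewrite ler_nat (leq_trans hk).
have be_n : 8 <= be * eps * n%:R.
  rewrite mulrC -ler_pdivrMr; last exact: mulr_gt0.
  apply: (le_trans hn2); apply: nR.
  by rewrite addnAC leq_addl.
have Ln : L.+1%:R <= n%:R :> R by apply: nR; rewrite leq_addl.
have n0 : 0 < n%:R :> R by apply: lt_le_trans Ln; rewrite ltr0n.
have n0' : (0 < n)%N by rewrite -(ltr0n R).
have eps_n : 8 <= eps * n%:R by apply: (le_trans be_n); rewrite ler_pM2r.
have be_n' : 8 <= be * n%:R.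
  apply: (le_trans be_n); rewrite ler_pM2r // ler_piMr ?(ltW be0) //.
  by move: eps1 eta11; clear; lra.
have gaE : 8 * ga = be * eps by rewrite /ga; clear; lra.
have epn0 : 0 <= eps * n%:R by apply: le_trans eps_n.
have [k /andP[hk1 hk2]] := floor_nat epn0.
pose G' := add_universal G k.+1.
have kR : (k.+1%:R : R) <= eps * n%:R + 1 by rewrite -natr1 lerD2r.
have kR' : eps * n%:R <= (k.+1%:R : R) by rewrite -natr1 ltW.
have cG' : #|G'| = (n + k.+1)%N by rewrite card_sum card_ord Gn.
have sumE (F : G' -> R) : \sum_(u : G') F u = \sum_v F (inl v) + \sum_j F (inr j).
  exact: big_sumType.
have [pos [pos_inj pos_lt pos_deg mono]] := degree_position G.
have cls_lt v : (pos v * L.+1 %/ n < L.+1)%N.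
  by rewrite ltn_divLR // mulnC ltn_pmul2l // -Gn.
(* A vertex of [G] gets its rounded degree rank; universal vertices go to the last class, so they
   are counted in no smaller segment. *)
pose cls (u : G') : 'I_L.+1 := match u with inl v => Ordinal (cls_lt v) | inr _ => ord_max end.
pose al' : R := a%:R / m%:R; pose be' : R := b%:R / m%:R.
have al'0 : 0 <= al' by rewrite divr_ge0.
have be'0 : 0 < be' by apply: lt_le_trans be'1.
have deg' (i : nat) : (1 <= i)%N -> i%:R <= be * #|G|%:R ->
    (1 - al - be) * #|G|%:R + al / be * i%:R <= (dseq G i)%:R.
  have xsh : x * sg < h.
    have : x * sg < 1 * sg by rewrite ltr_pM2r // (lt_le_trans ltr01).
    have : sg <= (S%:R + 1) * sg by rewrite ler_peMl ?(le_trans ler01) // lerDr ltW.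
    move: sghR; clear; lra.
  have sgh1 : sg < h.
    have : 1 * sg <= S%:R * sg by rewrite ler_wpM2r // (le_trans ler01).
    move: sghR sgR; clear; lra.
  have rS : s.+2%:R - 1 = S%:R :> R by rewrite -[s.+2%:R]natr1 addrK.
  have beE : (h - x * sg) / ((s.+2%:R - 1) * h) = be.
    by rewrite rS /be /al; field; rewrite !gt_eqF.
  have gE : gH H x - x * sg / h = 1 - al - be.
    rewrite /gH /chi_cr hr rS /be /al -/sg -/h; field.
    by rewrite !gt_eqF ?subr_gt0.
  have abE : (s.+2%:R - 1) * x * sg / (h - x * sg) = al / be.
    by rewrite rS /be /al; field; rewrite !gt_eqF ?subr_gt0 // ?mul1r ?subr_gt0.
  by move=> i1 ib; have := deg i i1; rewrite beE gE abE -Gn; apply.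
have cls01 u : 0 <= ((cls u)%:R / L.+1%:R : R) by rewrite divr_ge0.
have BE u : be + al * Num.max 0 (1 - (cls u)%:R / L.+1%:R / be) <=
    be' + al' * Num.max 0 (1 - (cls u)%:R / L.+1%:R / be') + 2 * ga.
  apply: le_trans (le_max_slope al'0 al'1 al'2 be0 be'1 (cls01 u) _) _.
    by rewrite invr_ge0 ltW.
  by rewrite lerD2l.
have B'0 u : be <= be' + al' * Num.max 0 (1 - (cls u)%:R / L.+1%:R / be').
  by rewrite -[leLHS]addr0 lerD // mulr_ge0 // le_max lexx.
have [|||||F [tF bF cF]] := tiling G' (@edge G') cls.
- exact: edge_sym.
- exact: edge_irrefl.
- by rewrite cG' (leq_trans _ (leq_addr _ _)) // (leq_trans _ n0n) // -addnA leq_addr.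
- move=> k'; rewrite sumE cG' natrD.
  have [kL|kL] := ltnP k' L.
    rewrite [X in _ + X]big1 //.
    rewrite addr0 /=.
    have /= := @count_positions R G pos L.+1 k' pos_inj pos_lt isT.
    rewrite Gn => /le_trans; apply.
    apply: (@le_trans _ _ (k'.+2%:R / L.+1%:R * n%:R)).
      rewrite -[k'.+2%:R]natr1 [(_ + 1) / _]mulrDl [leRHS]mulrDl lerD2l.
      by rewrite mul1r mulrC ler_pdivlMr ?ltr0n // mul1r.
    by rewrite ler_wpM2l ?divr_ge0 // lerDl.
  have c1 : 1 <= k'.+2%:R / L.+1%:R :> R.
    by rewrite ler_pdivlMr ?ltr0n // mul1r ler_nat ltnS (leq_trans kL).
  apply: (@le_trans _ _ (1 * (n%:R + k.+1%:R))); last first.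
    by rewrite ler_wpM2r // addr_ge0.
  rewrite mul1r lerD //.
    rewrite -Gn -sumr_const; apply: ler_sum => v _; by rewrite lern1 leq_b1.
  rewrite -[X in _ <= X%:R](card_ord k.+1) -sumr_const; apply: ler_sum => v _.
  by rewrite lern1 leq_b1.
- have gan : 1 <= ga * n%:R by move: be_n; rewrite -gaE; clear; lra.
  have gak : ga * k.+1%:R <= 2 * (ga * n%:R).
    have : ga * k.+1%:R <= ga * (2 * n%:R).
      rewrite ler_pM2l //; apply: (le_trans kR).
      have : eps * n%:R <= 1 * n%:R.
        by rewrite ler_pM2r //; move: eps1 eta11; clear; lra.
      have : 1 <= n%:R :> R by rewrite ler1n.
      clear; lra.
    clear; lra.
  move=> [v|j]; rewrite sumE cG' natrD.
    rewrite [X in _ + X]big1 //= addr0.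
    have rn : ((cls (inl v))%:R / L.+1%:R : R) * #|G|%:R <= (pos v)%:R.
      rewrite Gn mulrAC ler_pdivrMr ?ltr0n // -!natrM ler_nat.
      exact: leq_trunc_div.
    have ben : 1 <= be * #|G|%:R by rewrite Gn; move: be_n'; clear; lra.
    have := missing_position al0 alb ben deg' mono (pos_lt v) (pos_deg v) rn.
    rewrite Gn => /le_trans; apply.
    have h1 := ler_wpM2r (ltW n0) (BE (inl v)).
    have h2 := B'0 (inl v).
    rewrite -/al' -/be'; move: h1 h2; set B' := be' + _; set B := be + _ => h1 h2.
    have h3 : be * (eps * n%:R) <= B' * k.+1%:R.
      apply: ler_pM => //; exact: ltW.
    move: gak gan; rewrite -gaE in be_n; have : be * (eps * n%:R) = 8 * (ga * n%:R).
      by rewrite [RHS]mulrA gaE mulrA.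
    move: h1 h3; clear; lra.
  (* A universal vertex misses only itself. *)
  rewrite [X in X + _]big1 ?add0r //=.
  rewrite (bigD1 j) //= eqxx big1 ?addr0 => [|i]; last by rewrite eq_sym => ->.
  have h2 := B'0 (inr j); rewrite -/al' -/be'; move: h2; set B' := be' + _ => h2.
  have h3 : (be - ga) * n%:R <= (B' - ga) * (n%:R + k.+1%:R).
    apply: ler_pM => //; [|by rewrite lerD2r|by rewrite lerDl].
    by move: gab be0; clear; lra.
  apply: (@le_trans _ _ 1); first by [].
  apply: le_trans h3.
  have : ga * n%:R <= be / 8 * n%:R by rewrite ler_pM2r.
  move: be_n'; clear; lra.
have h_pos : (0 < #|H|)%N by apply: leq_trans sgh; rewrite muln_gt0.
have [TT tTT cTT] := union_tiling h_pos tF (fun B BF =>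
  bottle_H_tiling hr hH Kb (proj1 (bF B BF))).
have [T tT cT] := restrict_tiling h_pos tTT.
exists T; split => //.
rewrite card_covered // natrM -/h.
have mR : 0 < m%:R :> R.
  by rewrite ltr0n /m addn_gt0; case/andP: ab => ->.
have cFm : #|cover F|%:R = #|F|%:R * m%:R :> R.
  rewrite -natrM -(eqP tF); congr _%:R; rewrite -sum_nat_const.
  by apply: eq_bigr => B /bF[].
have cTR : #|F|%:R * (S * K)%:R <= #|T|%:R + k.+1%:R :> R.
  by rewrite -natrM -natrD ler_nat -cTT.
(* [q] is the tiled proportion of a bottle. Bottles that leave vertices uncovered, together with
   [q < x], cost [eta1 / 2], and the discarded copies cost [eta1 / 4], which is less than [eta] in
   total. *)
set q := (S * K * #|H|)%:R / m%:R in q1 q2.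
have q0 : 0 <= q by rewrite divr_ge0.
have qE : #|F|%:R * (S * K)%:R * h = q * (#|F|%:R * m%:R).
  by rewrite /q [(_ * #|H|)%:R]natrM -/h; field; rewrite gt_eqF.
have c1 := ler_wpM2l q0 cF.
rewrite cFm -qE cG' natrD in c1.
have c2 : q * ((1 - eta1 / 4) * n%:R) <= q * ((1 - eta1 / 4) * (n%:R + k.+1%:R)).
  rewrite ler_wpM2l // ler_wpM2l ?lerDl //; move: eta11; clear; lra.
have c3 := ler_wpM2r (ltW h0) cTR.
have c4 : k.+1%:R * h <= eta1 / 4 * n%:R.
  apply: (@le_trans _ _ ((eps * n%:R + 1) * h)); first by rewrite ler_pM2r.
  have : 1 * h <= eps * n%:R * h by rewrite ler_pM2r //; move: eps_n; clear; lra.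
  have : eps * n%:R * h = eta1 / 8 * n%:R by rewrite mulrAC epsh.
  clear; lra.
have c5 : (x - eta1 / 2) * n%:R <= q * ((1 - eta1 / 4) * n%:R).
  rewrite mulrA ler_pM2r //.
  have : q * (eta1 / 4) <= 1 * (eta1 / 4).
    rewrite ler_wpM2r //; [move: eta10; clear; lra|move: q2 x1; clear; lra].
  have : ga <= eps / 8 by rewrite /ga; move: beps; clear; lra.
  have Kga' : K0.+1%:R^-1 <= 2 * ga := Kga.
  move: q1 Kga' eps1 eta10; move: (K0.+1%:R^-1) => d; clear; lra.
have c6 : (x - eta) * n%:R <= (x - 3 / 4 * eta1) * n%:R.
  rewrite ler_pM2r //; move: eta1e eta10; clear; lra.
move: c1 c2 c3 c4 c5 c6; clear; lra.
Qed.
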